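(* Let $\rho>0$, consider Algorithm 2 (described in the context) with parameters $\hat\sigma,\theta,\hat\theta,\eta,\tau,\lambda_1$, let $d_0$ be the distance from $x_0$ to the solution set $(F+N_C)^{-1}(0)$, and let $\sigma:=\frac{2\hat\theta}{\eta L}$ (so $0<\sigma<1$). Then: (a) Algorithm 2 finds $y\in\mathcal H$ and $\nu\in N_C(y)$ with $\|F(y)+\nu\|\le\rho$ in at most $$\left\lceil\Big(\frac{2}{\tau\eta(1-\sigma)}\Big)\frac{d_0^2}{\rho}\right\rceil+\left\lceil\frac{1}{2\tau}\log^+\Big(\frac{\eta+2\hat\theta/L}{\lambda_1^2\rho}\Big)\right\rceil$$ iterations; (b) Algorithm 2 finds a triple $(y,v,\varepsilon)\in\mathcal H\times\mathcal H\times\mathbb R_+$ with $v\in(F+N_C)^\varepsilon(y)$ and $\max\{\|v\|,\varepsilon\}\le\rho$ in at most $$\max\left\{\left\lceil\Big(\frac{2\sqrt[3]{4}}{\tau\eta^{2/3}(1-\sigma^2)^{1/3}}\Big)\Big(\frac{d_0^2}{\rho}\Big)^{2/3}\right\rceil,\left\lceil\Big(\frac{2\sqrt[3]{4}}{\tau\eta^{2/3}(1-\sigma^2)^{2/3}}\Big)\Big(\frac{d_0^3}{\rho}\Big)^{2/3}\right\rceil\right\}+\left\lceil\frac{1}{2\tau}\log^+\Big(\frac{\eta+2\hat\theta/L}{\lambda_1^2\rho}\Big)\right\rceil$$ iterations.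
   Context: Setting: $\mathcal H$ real Hilbert space; $C\subseteq\mathcal H$ nonempty closed convex; $N_C(x)=\{\nu:\langle\nu,y-x\rangle\le0\ \forall y\in C\}$ if $x\in C$, $N_C(x)=\emptyset$ otherwise. $F:C\to\mathcal H$ is monotone, continuously differentiable, and $\|F'(x)-F'(y)\|\le L\|x-y\|$ for all $x,y\in C$, with $L>0$; the set $(F+N_C)^{-1}(0)$ of $x$ with $0\in F(x)+N_C(x)$ is nonempty. For $y\in C$, $F_y(x):=F(y)+F'(y)(x-y)$. For set-valued $T$ and $\varepsilon\ge0$, $T^\varepsilon(x)=\{v:\langle v-u,x-z\rangle\ge-\varepsilon\ \forall z,\ \forall u\in T(z)\}$. $\log^+(t)=\max\{\log t,0\}$. Parameters: $0\le\hat\sigma<1/2$; $0<\theta<(1-\hat\sigma)(1-2\hat\sigma)$; $\hat\theta:=\theta\big(\frac{\hat\sigma}{1-\hat\sigma}+\frac{\theta}{(1-\hat\sigma)^2}\big)$; $\eta>2\hat\theta/L$; $\tau:=\dfrac{2(\theta-\hat\theta)}{2\theta+\frac{\eta L}{2}+\sqrt{(2\theta+\frac{\eta L}{2})^2-4\theta(\theta-\hat\theta)}}$ (one has $0<\tau<1$). Algorithm 2: input $x_0\in C$, $y_0:=x_0$, $\nu_0:=0$, $\lambda_1>0$ with $\lambda_1^2\|F(y_0)\|\le2\theta/L$. For $k=1,2,\dots$: if $F(y_{k-1})+\nu_{k-1}=0$, stop and return $y_{k-1}$. If $\frac{\lambda_kL}{2}\|\lambda_k(F(y_{k-1})+\nu_{k-1})+y_{k-1}-x_{k-1}\|\le\hat\theta$,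 set $y_k=y_{k-1}$, $\nu_k=\nu_{k-1}$; otherwise find any $(y_k,\nu_k)$ with $\nu_k\in N_C(y_k)$ and $\|\lambda_k(F_{y_{k-1}}(y_k)+\nu_k)+y_k-x_{k-1}\|\le\hat\sigma\|y_k-y_{k-1}\|$. Then, if $\lambda_k\|y_k-x_{k-1}\|\ge\eta$, set $x_k=x_{k-1}-\tau\lambda_k(F(y_k)+\nu_k)$ and $\lambda_{k+1}=(1-\tau)\lambda_k$; else set $x_k=x_{k-1}$ and $\lambda_{k+1}=\lambda_k/(1-\tau)$. Standing assumption: the algorithm never stops at the first test, i.e. $F(y_{k-1})+\nu_{k-1}\neq0$ for all $k$. ''Finds within $M$ iterations'' means that a pair/triple with the stated property is available among the quantities computed in the first $M$ iterations (the pairs $(y_k,\nu_k)$, or weighted ergodic averages of $y_k$ and $F(y_k)+\nu_k$ with weights $\lambda_k$ over the iterations with $\lambda_k\|y_k-x_{k-1}\|\ge\eta$, with $\varepsilon$ the corresponding weighted average of $\langle y_k-\bar y,F(y_k)+\nu_k-\bar v\rangle$). *)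

(* Defs.v *)
From HB Require Import structures.
From mathcomp Require Import all_boot all_order all_algebra.
From mathcomp Require Import all_classical all_reals all_analysis.
Set Implicit Arguments. Unset Strict Implicit. Unset Printing Implicit Defensive.
Import Order.TTheory GRing.Theory Num.Theory.
Import numFieldNormedType.Exports.
Local Open Scope classical_set_scope.
Local Open Scope ring_scope.

Section Defs.
Variables (R : realType) (H : completeNormedModType R).

(* [ip] is an inner product on H inducing its norm: H is a real Hilbert space *)
Definition is_inner_product (ip : H -> H -> R) : Prop :=
  [/\ (forall x y, ip x y = ip y x),
      (forall a x y z, ip (a *: x + y) z = a * ip x z + ip y z) &
      (forall x, `|x| ^+ 2 = ip x x)].

Definition normal_cone (ip : H -> H -> R) (C : set H) (x : H) : set H :=
  [set nu | C x /\ forall y, C y -> ip nu (y - x) <= 0].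

Definition monotone_on (ip : H -> H -> R) (C : set H) (F : H -> H) : Prop :=
  forall x y, C x -> C y -> 0 <= ip (F x - F y) (x - y).

(* F' y is a bounded linear operator which is the derivative of F at y,
   relative to C (F is only defined on C) *)
Definition derivative_on (C : set H) (F : H -> H) (F' : H -> H -> H) : Prop :=
  forall y, C y ->
    [/\ (forall a u v, F' y (a *: u + v) = a *: F' y u + F' y v),
        (exists M : R, forall u, `|F' y u| <= M * `|u|) &
        (forall e : R, 0 < e -> exists d : R, 0 < d /\
           forall x, C x -> `|x - y| < d ->
             `|F x - F y - F' y (x - y)| <= e * `|x - y|)].

(* ||F'(x) - F'(y)|| <= L ||x - y|| (operator norm, unfolded) *)
Definition lipschitz_deriv_on (C : set H) (F' : H -> H -> H) (L : R) : Prop :=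
  forall x y, C x -> C y -> forall h, `|F' x h - F' y h| <= L * `|x - y| * `|h|.

Definition FNC (ip : H -> H -> R) (C : set H) (F : H -> H) (z : H) : set H :=
  [set F z + nu | nu in normal_cone ip C z].

Definition enlargement (ip : H -> H -> R) (T : H -> set H) (eps : R) (x : H)
  : set H :=
  [set v | forall z u, T z u -> - eps <= ip (v - u) (x - z)].

Definition dist_to (S : set H) (x0 : H) : R := inf [set `|x0 - x| | x in S].

Definition Flin (F : H -> H) (F' : H -> H -> H) (y x : H) : H :=
  F y + F' y (x - y).

End Defs.

Definition logp (R : realType) (t : R) : R := Num.max (ln t) 0.

Definition thetah (R : realType) (sh th : R) : R :=
  th * (sh / (1 - sh) + th / (1 - sh) ^+ 2).

Definition tau_of (R : realType) (sh th eta L : R) : R :=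
  2 * (th - thetah sh th) /
  (2 * th + eta * L / 2 +
   Num.sqrt ((2 * th + eta * L / 2) ^+ 2 - 4 * th * (th - thetah sh th))).

Section Alg.
Variables (R : realType) (H : completeNormedModType R).
Variables (ip : H -> H -> R) (C : set H) (F : H -> H) (F' : H -> H -> H).
Variables (L sh th eta lam1 : R) (x0 : H).

(* (x, y, nu, lam) is a run of Algorithm 2 (lam indexed from 1; lam 0 unused) *)
Definition alg2_run (x y nu : nat -> H) (lam : nat -> R) : Prop :=
  let thh := thetah sh th in
  let tau := tau_of sh th eta L in
  [/\ x 0%N = x0, y 0%N = x0, nu 0%N = 0, lam 1%N = lam1 &
   forall k : nat, (1 <= k)%N ->
     ((lam k * L / 2 * `|lam k *: (F (y k.-1) + nu k.-1) + y k.-1 - x k.-1|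
         <= thh
       /\ y k = y k.-1 /\ nu k = nu k.-1)
      \/
      (~ (lam k * L / 2 * `|lam k *: (F (y k.-1) + nu k.-1) + y k.-1 - x k.-1|
         <= thh)
       /\ normal_cone ip C (y k) (nu k)
       /\ `|lam k *: (Flin F F' (y k.-1) (y k) + nu k) + y k - x k.-1|
            <= sh * `|y k - y k.-1|))
     /\
     ((eta <= lam k * `|y k - x k.-1|
       /\ x k = x k.-1 - (tau * lam k) *: (F (y k) + nu k)
       /\ lam k.+1 = (1 - tau) * lam k)
      \/
      (~ (eta <= lam k * `|y k - x k.-1|)
       /\ x k = x k.-1 /\ lam k.+1 = lam k / (1 - tau)))].

Variables (x y nu : nat -> H) (lam : nat -> R).

Definition succ_it (k : nat) : bool := eta <= lam k * `|y k - x k.-1|.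

Definition Lam_sum (m : nat) : R := \sum_(1 <= k < m.+1 | succ_it k) lam k.

Definition ybar (m : nat) : H :=
  (Lam_sum m)^-1 *: \sum_(1 <= k < m.+1 | succ_it k) (lam k *: y k).

Definition vbar (m : nat) : H :=
  (Lam_sum m)^-1 *: \sum_(1 <= k < m.+1 | succ_it k) (lam k *: (F (y k) + nu k)).

Definition epsbar (m : nat) : R :=
  (Lam_sum m)^-1 * \sum_(1 <= k < m.+1 | succ_it k)
     (lam k * ip (y k - ybar m) (F (y k) + nu k - vbar m)).

End Alg.

(* Main.v *)
(* Write v_k = F(y_k) + nu_k and r_k = lam_k v_k + y_k - x_{k-1}.  One Newton step brings
   (lam_k L / 2) |r_k| from at most theta down to at most thetah, and tau is the root of
   theta (1 - tau)^2 = thetah + tau eta L / 2, which is exactly what restores the bound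
   theta after either update of (x, lam).  At a large step (lam_k |y_k - x_{k-1}| >= eta)
   the residual is then relative, |r_k| <= sigma |y_k - x_{k-1}|, so x_k is a relaxed hybrid
   proximal-extragradient step and |x_k - x*|^2 telescopes: this bounds
   sum |y_k - x_{k-1}|^2 over the large steps, hence the sum of |v_k| and, from below, the
   sum of lam_k.  A small step divides lam by 1 - tau, while
   lam_k^2 |v_k| < eta + 2 thetah / L there, so as long as |v_k| > rho small steps outnumber
   large ones by at most the logarithmic term; M iterations thus contain about M / 2 large
   ones.  The ceilings leave no room to spare: they need d_0 > 0, which holds because a run
   started at a solution either stops or never moves. *)
Require Import Defs.
From HB Require Import structures.
From mathcomp Require Import all_boot all_order all_algebra.
From mathcomp Require Import all_classical all_reals all_analysis.
From mathcomp Require Import ring lra.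
Set Implicit Arguments. Unset Strict Implicit. Unset Printing Implicit Defensive.
Import Order.TTheory GRing.Theory Num.Theory.
Import numFieldNormedType.Exports.
Local Open Scope classical_set_scope.
Local Open Scope ring_scope.

(** * Smooth monotone operators on a convex set *)

(** The derivative is given by an estimate confined to the unit interval, the form that
    [derivative_on] yields along a segment of [C]. At interior points it is a genuine derivative and
    everywhere it gives continuity, which is what the mean value theorem asks for. *)
Lemma le_of_derivative_le0 (R : realType) (g dg : R -> R) :
  (forall t, 0 <= t <= 1 -> forall e, 0 < e ->
     exists2 d, 0 < d & forall s, 0 <= s <= 1 -> `|s - t| < d ->
       `|g s - g t - dg t * (s - t)| <= e * `|s - t|) ->
  (forall t, 0 <= t <= 1 -> dg t <= 0) -> g 1 <= g 0.
Proof.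
move=> hg hdg.
have [||c] := @MVT_segment R g dg 0 1 ler01.
- move=> t /[!in_itv] /= /andP[t0 t1].
  have t01 : 0 <= t <= 1 by rewrite !ltW.
  suff h : (fun h : R => h^-1 *: ((g \o shift t) (h *: (1 : R)) - g t)) @ 0^' --> dg t.
    by apply: DeriveDef; [apply/cvg_ex; exists (dg t) | exact/cvg_lim].
  apply/cvgrPdist_le => e e0.
  have [d d0 hd] := hg t t01 e e0.
  near=> h.
  have h0 : h != 0 by near: h; exact: nbhs_dnbhs_neq.
  (* The bounds [t] and [1 - t] keep [h + t] in the unit interval, where the estimate applies. *)
  have hlt : `|h| < Num.min d (Num.min t (1 - t)).
    near: h; apply: dnbhs0_lt; rewrite !lt_min d0 t0 /=; lra.
  have := hlt; rewrite !lt_min => /and3P[hd1 /ltr_normlP [ht1 ht2] /ltr_normlP [ht3 ht4]].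
  have := hd (h + t); rewrite addrK => /(_ _ hd1) H.
  rewrite /= [h *: 1]mulr1.
  have -> : dg t - h^-1 *: (g (h + t) - g t) =
            - (h^-1 * (g (h + t) - g t - dg t * h)).
    by rewrite mulrBr [_ * (_ * h)]mulrCA mulVf// mulr1 opprB.
  rewrite normrN normrM normfV ler_pdivrMl ?normr_gt0// [leRHS]mulrC.
  by apply: H; lra.
- apply/subspace_continuousP => t /=; rewrite in_itv /= => t01.
  apply/cvgrPdist_le => e e0.
  have [d d0 hd] := hg t t01 1 ltr01.
  have K0 : 0 < 1 + `|dg t| by rewrite ltr_pwDl.
  rewrite near_withinE; near=> s => /=; rewrite in_itv /= => s01.
  have hst : `|s - t| < Num.min d (e / (1 + `|dg t|)).
    rewrite distrC; near: s; apply: (@cvgr_dist_lt _ _ _ (nbhs t) _ id) => //.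
    by rewrite lt_min d0 divr_gt0.
  move: hst; rewrite lt_min => /andP[h1 h2].
  have h3 := hd s s01 h1.
  rewrite distrC.
  have -> : g s - g t = (g s - g t - dg t * (s - t)) + dg t * (s - t) by ring.
  apply: le_trans (ler_normD _ _) _; rewrite normrM.
  move: h2; rewrite ltr_pdivlMr // => h2; lra.
- rewrite in_itv /= => /andP[c0 c1].
  have := hdg c; rewrite c0 c1 => /(_ isT) h; lra.
Unshelve. all: by end_near.
Qed.

Section InnerProduct.
Variables (R : realType) (H : completeNormedModType R) (ip : H -> H -> R).
Hypothesis ipP : is_inner_product ip.
Implicit Types (x y z w : H) (a : R).

Lemma ipC x y : ip x y = ip y x.
Proof. by case: ipP. Qed.

Lemma ip_sqr x : ip x x = `|x| ^+ 2.
Proof. by case: ipP => _ _ ->. Qed.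

Lemma ipDl x y z : ip (x + y) z = ip x z + ip y z.
Proof. by case: ipP => _ h _; rewrite -[x]scale1r h mul1r scale1r. Qed.

Lemma ip0l z : ip 0 z = 0.
Proof. by have := ipDl 0 0 z; rewrite addr0 => h; lra. Qed.

Lemma ipZl a x z : ip (a *: x) z = a * ip x z.
Proof. by case: ipP => _ h _; rewrite -[a *: x]addr0 h ip0l addr0. Qed.

Lemma ipNl x z : ip (- x) z = - ip x z.
Proof. by rewrite -scaleN1r ipZl mulN1r. Qed.

Lemma ipBl x y z : ip (x - y) z = ip x z - ip y z.
Proof. by rewrite ipDl ipNl. Qed.

Lemma ip0r z : ip z 0 = 0.
Proof. by rewrite ipC ip0l. Qed.

Lemma ipDr x y z : ip x (y + z) = ip x y + ip x z.
Proof. by rewrite !(ipC x) ipDl. Qed.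

Lemma ipZr a x z : ip x (a *: z) = a * ip x z.
Proof. by rewrite !(ipC x) ipZl. Qed.

Lemma ipNr x z : ip x (- z) = - ip x z.
Proof. by rewrite !(ipC x) ipNl. Qed.

Lemma ipBr x y z : ip x (y - z) = ip x y - ip x z.
Proof. by rewrite ipDr ipNr. Qed.

Definition ipE := (ipBl, ipBr, ipDl, ipDr, ipNl, ipNr, ipZl, ipZr).

Lemma sqr_normB x y : `|x - y| ^+ 2 = `|x| ^+ 2 - 2 * ip y x + `|y| ^+ 2.
Proof. by rewrite -!ip_sqr !ipE (ipC x y); ring. Qed.

(* Turns identities between vectors into ring identities between inner products. *)
Lemma ip_inj x y : (forall w, ip x w = ip y w) -> x = y.
Proof.
move=> h; apply/eqP; rewrite -subr_eq0 -normr_eq0 -sqrf_eq0 -ip_sqr.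
by rewrite ipBl h subrr.
Qed.

Definition ipEl := (ipBl, ipDl, ipNl, ipZl).

Lemma ip_suml (I : Type) (r : seq I) (P : pred I) (f : I -> H) z :
  ip (\sum_(i <- r | P i) f i) z = \sum_(i <- r | P i) ip (f i) z.
Proof. by apply: (big_morph (ip^~ z)) => [u v|]; rewrite ?ipDl ?ip0l. Qed.

Lemma ip_le x y : ip x y <= `|x| * `|y|.
Proof.
have [->|x0] := eqVneq x 0; first by rewrite ip0l normr0 mul0r.
have [->|y0] := eqVneq y 0; first by rewrite ip0r normr0 mulr0.
have : 0 <= ip (`|y| *: x - `|x| *: y) (`|y| *: x - `|x| *: y).
  by rewrite ip_sqr sqr_ge0.
rewrite !ipE (ipC y x) !ip_sqr.
have : 0 < `|x| * `|y| by rewrite mulr_gt0 ?normr_gt0.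
set p := `|x| * `|y| => p0 h.
by rewrite -(ler_pM2l p0) /p; lra.
Qed.

Lemma ip_norm_le x y : `|ip x y| <= `|x| * `|y|.
Proof.
by rewrite ler_norml ip_le andbT -[ip x y]opprK -ipNl lerN2 (le_trans (ip_le _ _))// normrN.
Qed.

End InnerProduct.

Section SmoothMonotone.
Variables (R : realType) (H : completeNormedModType R) (ip : H -> H -> R).
Variables (C : set H) (F : H -> H) (F' : H -> H -> H) (L : R).
Hypotheses (ipP : is_inner_product ip) (convC : convex_set C).
Hypotheses (monF : monotone_on ip C F) (dF : derivative_on C F F').
Hypothesis (lipF' : lipschitz_deriv_on C F' L).

Lemma convex_segment (y z : H) (t : R) :
  C y -> C z -> 0 <= t <= 1 -> C (y + t *: (z - y)).
Proof.
move=> Cy Cz /andP[t0 t1].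
have ti : Itv.spec (@Itv.num_sem R) (Itv.Real `[0%Z, 1%Z]) t.
  by rewrite /= /Itv.num_sem /= ger0_real// in_itv /= t0 t1.
have := @convC z y (Itv.mk ti); rewrite !inE => /(_ Cz Cy).
rewrite (_ : y + t *: (z - y) = t *: z + (1 - t) *: y) //.
by rewrite scalerBl scale1r scalerBr addrCA.
Qed.

Lemma deriv_lin y (a : R) u : C y -> F' y (a *: u) = a *: F' y u.
Proof.
case/dF => lin _ _.
have F'0 : F' y 0 = 0.
  have := lin 1 0 0; rewrite !scale1r addr0 => e.
  by apply: (@addrI _ (F' y 0)); rewrite addr0 -e.
by rewrite -[a *: u]addr0 lin F'0 addr0.
Qed.

(** A negative value in the direction [h] would contradict monotonicity between [y] and [y + t h]
    for small [t], because the first-order error is at most [e t |h|]. *)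
Lemma deriv_monotone y z : C y -> C z -> 0 <= ip (F' y (z - y)) (z - y).
Proof.
move=> Cy Cz; rewrite leNgt; apply/negP; set h := z - y => q0.
have n0 := normr_ge0 h.
(* With this [e], the error [e |h|^2] stays below the size of the supposed negative value; the [+ 1]
   avoids a zero denominator. *)
have e0 : 0 < - ip (F' y h) h / (`|h| ^+ 2 + 1).
  by rewrite divr_gt0 ?oppr_gt0// ltr_wpDl// sqr_ge0.
have [_ _ /(_ _ e0)[d [d0 hd]]] := dF Cy.
set e := - ip (F' y h) h / (`|h| ^+ 2 + 1) in e0 hd.
pose t := Num.min 1 (d / (`|h| + 1)).
have t0 : 0 < t by rewrite lt_min ltr01 divr_gt0// ltr_wpDl.
have t1 : t <= 1 by rewrite ge_min lexx.
have td : t * `|h| < d.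
  have : t <= d / (`|h| + 1) by rewrite ge_min lexx orbT.
  rewrite ler_pdivlMr ?ltr_wpDl// => ?; nra.
have Cx : C (y + t *: h) by apply: convex_segment => //; rewrite t1 ltW.
have := hd _ Cx; rewrite addrAC subrr add0r normrZ (gtr0_norm t0) => /(_ td).
have := monF Cx Cy; rewrite addrAC subrr add0r deriv_lin//.
set D := F _ - F y => m1 m2; clearbody D.
have := ip_le ipP (D - t *: F' y h) h; rewrite (ipBl ipP) (ipZl ipP) => m3.
move: m1; rewrite (ipZr ipP) pmulr_rge0// => m1.
have : ip D h - t * ip (F' y h) h <= e * (t * `|h|) * `|h|.
  by apply: le_trans m3 _; rewrite ler_wpM2r.
have -> : e * (t * `|h|) * `|h| = t * (e * `|h| ^+ 2) by ring.
have : e * `|h| ^+ 2 < - ip (F' y h) h.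
  rewrite /e mulrAC ltr_pdivrMr ?ltr_wpDl ?sqr_ge0//.
  by rewrite ltr_pM2l ?oppr_gt0// ltrDl.
move=> k1 k2.
have : t * (e * `|h| ^+ 2 + ip (F' y h) h) < 0 by rewrite pmulr_rlt0//; lra.
rewrite mulrDr => k3; lra.
Qed.

(** Taylor's bound without integrals: pair the error [w] with itself. Along the segment, the
    derivative of [g] is nonpositive by Cauchy-Schwarz and the Lipschitz bound, so [g 1 <= g 0],
    which reads [|w|^2 <= K / 2]; then divide by [|w|]. *)
Lemma linearization_error y z : C y -> C z ->
  `|F z - F y - F' y (z - y)| <= L / 2 * `|z - y| ^+ 2.
Proof.
move=> Cy Cz; set h := z - y; set w := F z - F y - _.
(* When [w = 0], the right-hand side is nonnegative because the Lipschitz bound between [z] and [y]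
   dominates a norm. *)
have [w0|w0] := eqVneq w 0.
  have := lipF' Cz Cy h; rewrite w0 normr0 -/h => /(le_trans (normr_ge0 _)).
  by rewrite -mulrA -expr2 mulrAC => h0; rewrite divr_ge0.
pose K := L * `|h| ^+ 2 * `|w|.
pose p t := y + t *: h.
have Cp t : 0 <= t <= 1 -> C (p t) by exact: convex_segment.
have K0 : 0 <= K.
  have := lipF' Cz Cy h; rewrite -/h => /(le_trans (normr_ge0 _)).
  by rewrite -mulrA -expr2 => h0; rewrite mulr_ge0.
pose g t := ip (F (p t) - t *: F' y h) w - K / 2 * t ^+ 2.
pose dg t := ip (F' (p t) h - F' y h) w - K * t.
have : g 1 <= g 0.
  apply: (@le_of_derivative_le0 _ g dg) => [t t01 e e0|t t01]; last first.
    rewrite subr_le0; apply: le_trans (ip_le ipP _ _) _.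
    have := lipF' (Cp t t01) Cy h.
    rewrite {2}/p addrAC subrr add0r normrZ => le1.
    have -> : K * t = L * (t * `|h|) * `|h| * `|w| by rewrite /K; ring.
    rewrite ler_wpM2r//; move: le1; rewrite ger0_norm//.
    by case/andP: t01.
  have n0 : 0 < 2 * (`|h| * `|w| + 1) by rewrite mulr_gt0// ltr_wpDl// mulr_ge0.
  have e10 : 0 < e / (2 * (`|h| * `|w| + 1)) by rewrite divr_gt0.
  have [_ _ /(_ _ e10)[d [d0 hd]]] := dF (Cp t t01).
  (* The first bound puts [p s] within [d] of [p t]; the second makes the quadratic term at most
     half of [e |s - t|]. *)
  exists (Num.min (d / (`|h| + 1)) (e / (K + 1))).
    by rewrite lt_min !divr_gt0// ltr_wpDl.
  move=> s s01; rewrite lt_min !ltr_pdivlMr ?ltr_wpDl// => /andP[s1 s2].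
  have ps : p s - p t = (s - t) *: h.
    by rewrite /p opprD addrACA subrr add0r -scalerBl.
  have := hd (p s) (Cp s s01); rewrite ps normrZ => /(_ _)/wrap[].
    by have := normr_ge0 h; have := normr_ge0 (s - t); nra.
  rewrite deriv_lin; last exact: Cp.
  set E := F (p s) - _ - _ => hE.
  have -> : g s - g t - dg t * (s - t) = ip E w - K / 2 * (s - t) ^+ 2.
    by rewrite /g /dg /E !(ipBl ipP, ipZl ipP); field.
  apply: le_trans (ler_normB _ _) _.
  have -> : e * `|s - t| = e / 2 * `|s - t| + e / 2 * `|s - t| by field.
  apply: lerD.
    apply: le_trans (ip_norm_le ipP _ _) _.
    apply: le_trans (ler_wpM2r (normr_ge0 _) hE) _.
    have n1 : 0 < `|h| * `|w| + 1 by rewrite ltr_wpDl// mulr_ge0.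
    rewrite [leLHS](_ : _ =
      e / 2 * `|s - t| * (`|h| * `|w| / (`|h| * `|w| + 1))); last first.
      by field; rewrite gt_eqF.
    rewrite ler_piMr ?mulr_ge0 ?divr_ge0 ?(ltW e0)// ler_pdivrMr//; lra.
  rewrite normrM normrX ger0_norm ?divr_ge0// expr2.
  have := normr_ge0 (s - t); nra.
have yh : y + h = z by rewrite /h addrC subrK.
rewrite /g /p !scale1r !scale0r addr0 subr0 yh expr1n expr0n mulr0 mulr1 subr0.
rewrite (ipBl ipP) => gle.
have : ip w w <= K / 2 by rewrite {1}/w !(ipBl ipP); lra.
rewrite (ip_sqr ipP) /K expr2 => hw.
have w1 : 0 < `|w| by rewrite normr_gt0.
by rewrite -(ler_pM2r w1); lra.
Qed.

End SmoothMonotone.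

(** * Step parameters and one-step estimates *)

Section StepParams.
Variables (R : realType) (L sh th eta : R).
Hypotheses (sh0 : 0 <= sh) (sh12 : sh < 1 / 2) (th0 : 0 < th).
Hypotheses (th_lt : th < (1 - sh) * (1 - 2 * sh)) (L0 : 0 < L).
Hypothesis (eta_gt : 2 * thetah sh th / L < eta).
Local Notation thh := (thetah sh th).
Local Notation tau := (tau_of sh th eta L).

Lemma thetah_gt0 : 0 < thh.
Proof.
have s1 : 0 < 1 - sh by have := sh12; lra.
by rewrite /thetah mulr_gt0// ltr_wpDl ?divr_ge0 ?divr_gt0 ?exprn_gt0// ltW.
Qed.

(** Divided by [th] and cleared of denominators, this is [th_lt], since [(1 - sh)^2 - sh (1 - sh) =
    (1 - sh) (1 - 2 sh)]. *)
Lemma thetah_lt : thh < th.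
Proof.
have s1 : 0 < 1 - sh by have := sh12; lra.
rewrite /thetah gtr_pMr//.
rewrite (_ : _ + _ = (sh * (1 - sh) + th) / (1 - sh) ^+ 2); last first.
  by field; rewrite gt_eqF.
rewrite ltr_pdivrMr ?exprn_gt0// mul1r; have := th_lt; lra.
Qed.

Lemma eta_gt0 : 0 < eta.
Proof. by apply: lt_trans eta_gt; rewrite divr_gt0// mulr_gt0// thetah_gt0. Qed.

Lemma sigma_lt1 : 2 * thh / (eta * L) < 1.
Proof.
rewrite ltr_pdivrMr ?mulr_gt0 ?eta_gt0// mul1r.
by move: eta_gt; rewrite ltr_pdivrMr.
Qed.

Lemma sigma_gt0 : 0 < 2 * thh / (eta * L).
Proof. exact: divr_gt0 (mulr_gt0 _ thetah_gt0) (mulr_gt0 eta_gt0 L0). Qed.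

Let b := eta * L / 2.
Let B := 2 * th + b.
Let s := Num.sqrt (B ^+ 2 - 4 * th * (th - thh)).

Let b0 : 0 < b. Proof. by rewrite divr_gt0 // mulr_gt0// eta_gt0. Qed.
Let B0 : 0 < B. Proof. by rewrite addr_gt0// mulr_gt0. Qed.
Let s0 : 0 <= s. Proof. exact: sqrtr_ge0. Qed.
Let tauE : tau = 2 * (th - thh) / (B + s). Proof. by []. Qed.

Lemma tau_gt0 : 0 < tau.
Proof.
rewrite tauE divr_gt0 ?mulr_gt0 ?subr_gt0 ?thetah_lt//.
by rewrite ltr_pwDl.
Qed.

Lemma tau_lt1 : tau < 1.
Proof.
have u0 : 0 < B + s by rewrite ltr_pwDl.
rewrite tauE ltr_pdivrMr// mul1r.
by have := thetah_gt0; have := b0; have := s0; rewrite /B; lra.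
Qed.

(** [tau] is the smaller root of [th t^2 - B t + (th - thh)], written with the square root in the
    denominator. *)
Lemma tau_root : th * (1 - tau) ^+ 2 = thh + tau * (eta * L / 2).
Proof.
have s2 : s ^+ 2 = B ^+ 2 - 4 * th * (th - thh).
  have := thetah_gt0; have := thetah_lt => h1 h2.
  rewrite sqr_sqrtr// /B; have := b0; nra.
have u0 : B + s != 0 by rewrite gt_eqF// ltr_pwDl.
apply/eqP; rewrite -subr_eq0 tauE -/b; apply/eqP.
rewrite (_ : _ - _ = (th - thh) / (B + s) ^+ 2 *
  (4 * th * (th - thh) - 2 * B * (B + s) + (B + s) ^+ 2)); last first.
  by rewrite /B; field.
by rewrite sqrrD s2; ring.
Qed.

End StepParams.

Section Steps.
Variables (R : realType) (H : completeNormedModType R) (ip : H -> H -> R).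
Hypothesis ipP : is_inner_product ip.

Lemma FNC_monotone (C : set H) (F : H -> H) (y z nu mu : H) :
  monotone_on ip C F -> normal_cone ip C y nu -> normal_cone ip C z mu ->
  0 <= ip (F y + nu - (F z + mu)) (y - z).
Proof.
move=> mon [Cy Ny] [Cz Nz].
have := mon _ _ Cy Cz; have := Ny _ Cz; have := Nz _ Cy.
by rewrite !(ipE ipP); lra.
Qed.

(* The linearized operator plus the identity is strongly monotone on [C], which gives
   [(1 - sh) * `|y' - y| <= `|r|]; the linearization error is quadratic in [`|y' - y|]. *)
Lemma newton_step (C : set H) (F : H -> H) (F' : H -> H -> H) (L sh th lam : R)
    (x y nu y' nu' : H) :
  convex_set C -> monotone_on ip C F -> derivative_on C F F' ->
  lipschitz_deriv_on C F' L -> 0 < L -> 0 <= sh -> sh < 1 -> 0 < lam ->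
  normal_cone ip C y nu -> normal_cone ip C y' nu' ->
  lam * L / 2 * `|lam *: (F y + nu) + y - x| <= th ->
  `|lam *: (Flin F F' y y' + nu') + y' - x| <= sh * `|y' - y| ->
  lam * L / 2 * `|lam *: (F y' + nu') + y' - x| <= thetah sh th.
Proof.
move=> convC monF dF lipF' L0 sh0 sh1 lam0 [Cy Ny] [Cy' Ny'].
set r := lam *: (F y + nu) + y - x; set e := lam *: (Flin F F' y y' + nu') + y' - x.
move=> hr he.
have psd := deriv_monotone ipP convC monF dF Cy Cy'.
have tay := linearization_error ipP convC dF lipF' Cy Cy'.
have n1 := Ny _ Cy'; have n2 := Ny' _ Cy.
have d_le : (1 - sh) * `|y' - y| <= `|r|.
  have [->|d0] := eqVneq (y' - y) 0; first by rewrite normr0 mulr0.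
  have {}d0 : 0 < `|y' - y| by rewrite normr_gt0.
  have i1 := ip_le ipP e (y' - y).
  have i2 := ip_le ipP (- r) (y' - y); rewrite normrN (ipNl ipP) in i2.
  have n3 : 0 <= ip (nu' - nu) (y' - y) by move: n1 n2; rewrite !(ipE ipP); lra.
  (* The difference [e - r] equals [lam (F' y d + nu' - nu) + d] with [d = y' - y]; paired with [d]
     it gives [|d|^2] plus nonnegative terms. *)
  have mono : `|y' - y| ^+ 2 <= ip e (y' - y) - ip r (y' - y).
    have n4 : 0 <= lam * (ip (F' y (y' - y)) (y' - y) + ip (nu' - nu) (y' - y)).
      by rewrite mulr_ge0 ?(ltW lam0)// addr_ge0.
    move: n4; rewrite -(ip_sqr ipP) /e /r /Flin.
    by set d := y' - y; rewrite {3}/d !(ipEl ipP); lra.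
  have : `|y' - y| * `|y' - y| <= (sh * `|y' - y| + `|r|) * `|y' - y| by nra.
  by rewrite ler_pM2r// => h; lra.
have d0 := normr_ge0 (y' - y).
have -> : lam *: (F y' + nu') + y' - x = e + lam *: (F y' - F y - F' y (y' - y)).
  by apply: (ip_inj ipP) => w; rewrite /e /Flin !(ipEl ipP); ring.
have h1 : `|e + lam *: (F y' - F y - F' y (y' - y))|
    <= sh * `|y' - y| + lam * (L / 2 * `|y' - y| ^+ 2).
  apply: le_trans (ler_normD _ _) _; apply: lerD => //.
  by rewrite normrZ gtr0_norm// ler_pM2l.
have s1 : 0 < 1 - sh by lra.
set d := `|y' - y| in d_le d0 he h1 *.
set q := lam * L / 2; have q0 : 0 < q by rewrite divr_gt0 ?mulr_gt0.
have qd : q * d <= th / (1 - sh).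
  rewrite ler_pdivlMr//; apply: le_trans hr.
  by rewrite -/q mulrAC -mulrA ler_pM2l.
apply: le_trans (ler_wpM2l (ltW q0) h1) _.
(* In the variable [q d] the bound is [sh (q d) + (q d)^2]; at [q d = th / (1 - sh)] this is the
   formula for [thetah]. *)
have -> : q * (sh * d + lam * (L / 2 * d ^+ 2)) = sh * (q * d) + (q * d) ^+ 2.
  by rewrite /q; field.
rewrite /thetah mulrDr; apply: lerD.
  by rewrite [leRHS]mulrCA ler_wpM2l.
have qd0 : 0 <= q * d by rewrite mulr_ge0 ?(ltW q0).
rewrite mulrA -expr2 -expr_div_n ler_pXn2r// nnegrE//.
exact: le_trans qd0 qd.
Qed.

(** Expand the square on the left and add [tau] times the squared residual bound. What remains is
    [tau (1 - tau) lam^2 |v|^2], nonnegative because the step is under-relaxed. *)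
Lemma relaxed_hpe_step (v x y z : H) (lam s tau : R) :
  0 < lam -> 0 <= s -> 0 < tau < 1 ->
  `|lam *: v + y - x| <= s * `|y - x| ->
  `|x - (tau * lam) *: v - z| ^+ 2 <=
  `|x - z| ^+ 2 - 2 * tau * lam * ip v (y - z) - tau * (1 - s ^+ 2) * `|y - x| ^+ 2.
Proof.
move=> lam0 s0 /andP[t0 t1].
rewrite -(ler_pXn2r (ltn0Sn 1)) ?nnegrE ?mulr_ge0// exprMn.
rewrite -!(ip_sqr ipP) => h.
have v0 : 0 <= tau * (1 - tau) * lam ^+ 2 * ip v v.
  by rewrite (ip_sqr ipP) !mulr_ge0 ?sqr_ge0 ?subr_ge0 ?(ltW t0) ?(ltW t1) ?(ltW lam0).
have {}h := ler_wpM2l (ltW t0) h.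
move: h v0; rewrite !(ipE ipP) (ipC ipP y v) (ipC ipP x v) (ipC ipP z v).
by rewrite (ipC ipP x y) (ipC ipP x z) => h v0; lra.
Qed.

(** With [a = |y - z|] and [b = |y - x|], the residual bound gives [<y - x, y - z> <= s a b], hence
    [|x - z|^2 >= a^2 - 2 s a b + b^2 = (1 - s^2) a^2 + (s a - b)^2]. *)
Lemma hpe_iterate_bound (v x y z : H) (lam s : R) :
  0 < lam -> 0 <= s -> `|lam *: v + y - x| <= s * `|y - x| ->
  0 <= ip v (y - z) -> (1 - s ^+ 2) * `|y - z| ^+ 2 <= `|x - z| ^+ 2.
Proof.
move=> lam0 s0 h hv.
have := ip_le ipP (lam *: v + y - x) (y - z).
have h1 : 0 <= lam * ip v (y - z) by rewrite mulr_ge0 ?(ltW lam0).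
have n1 := normr_ge0 (y - z); have n2 := normr_ge0 (y - x).
have e1 : x - z = (y - z) - (y - x).
  by apply: (ip_inj ipP) => w; rewrite !(ipEl ipP); ring.
rewrite e1 (sqr_normB ipP (y - z)).
rewrite -(addrA (lam *: v)) (ipDl ipP (lam *: v)) (ipZl ipP) => h2.
have h3 := ler_wpM2r n1 h; rewrite -(addrA (lam *: v)) in h3.
have := sqr_ge0 (s * `|y - z| - `|y - x|).
move: h1 h2 h3; move: (ip _ _) (`|lam *: v + (y - x)| * _) => p q h1 h2 h3. nra.
Qed.

End Steps.

(** * Counting and summation *)

(* [l -> l ^- 2] is convex: sum its tangent-line bound at the mean of the [l i]. *)
Lemma sum_large_steps (R : realFieldType) (I : eqType) (r : seq I) (P : pred I)
    (l a : I -> R) (e : R) :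
  0 < e -> (forall i, P i -> 0 < l i /\ e <= l i * a i) ->
  (\sum_(i <- r | P i) 1) ^+ 3 * e ^+ 2 <=
  (\sum_(i <- r | P i) l i) ^+ 2 * \sum_(i <- r | P i) a i ^+ 2.
Proof.
move=> e0 h; set A := \sum_(i <- r | P i) 1; set Lam := \sum_(i <- r | P i) l i.
have sq0 : 0 <= \sum_(i <- r | P i) a i ^+ 2.
  by apply: sumr_ge0 => i _; exact: sqr_ge0.
have A0 : 0 <= A by exact: sumr_ge0.
have [A1|A1] := eqVneq A 0; first by rewrite A1 expr0n mul0r mulr_ge0// sqr_ge0.
have {}A0 : 0 < A by rewrite lt_neqAle eq_sym A1.
have L0 : 0 < Lam.
  rewrite lt_neqAle eq_sym sumr_ge0 ?andbT => [|i /h[/ltW]//].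
  move: A1; rewrite !psumr_neq0// => [|i /h[/ltW]//]; apply: sub_has => i /andP[Pi _].
  by rewrite Pi; case: (h i Pi).
pose mu := Lam / A.
have mu0 : 0 < mu by rewrite divr_gt0.
have tangent i : P i -> e ^+ 2 * (3 / mu ^+ 2 - 2 / mu ^+ 3 * l i) <= a i ^+ 2.
  move=> /h[l0 ea].
  have : 0 <= (mu - l i) ^+ 2 * (mu + 2 * l i).
    apply: mulr_ge0; first exact: sqr_ge0.
    by rewrite addr_ge0 ?(ltW mu0)// mulr_ge0 ?(ltW l0).
  move=> tl.
  have : e ^+ 2 <= (l i * a i) ^+ 2 by rewrite ler_pXn2r// nnegrE ltW// (lt_le_trans e0).
  rewrite exprMn -ler_pdivrMl ?exprn_gt0// => le2; apply: le_trans le2.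
  rewrite mulrC ler_pM2r ?exprn_gt0// -subr_ge0.
  (* The gap between [l^-2] and its tangent at [mu], in factored form. *)
  rewrite (_ : _ - _ = (mu - l i) ^+ 2 * (mu + 2 * l i) / (mu ^+ 3 * l i ^+ 2)).
    apply: divr_ge0; first exact: tl.
    by apply: mulr_ge0; apply: exprn_ge0; apply: ltW.
  by field; rewrite !gt_eqF.
have : \sum_(i <- r | P i) e ^+ 2 * (3 / mu ^+ 2 - 2 / mu ^+ 3 * l i) <=
    \sum_(i <- r | P i) a i ^+ 2 by exact: ler_sum.
rewrite -mulr_sumr sumrB -(mulr_sumr _ _ l) -/Lam.
have -> : \sum_(i <- r | P i) 3 / mu ^+ 2 = 3 / mu ^+ 2 * A.
  by rewrite mulr_sumr; apply: eq_bigr => i _; rewrite mulr1.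
have -> : e ^+ 2 * (3 / mu ^+ 2 * A - 2 / mu ^+ 3 * Lam) = A ^+ 3 * e ^+ 2 / Lam ^+ 2.
  by rewrite /mu; field; rewrite !gt_eqF.
by rewrite ler_pdivrMr ?exprn_gt0// mulrC [leRHS]mulrC.
Qed.

(** Since [1 - t <= exp (- t)], the squared power is at most [exp (- 2 t c)]; this is the source of
    the factor [(2 * t)^-1] in the iteration count. *)
Lemma logp_power_le1 (R : realType) (t Q : R) (c : nat) :
  0 < t < 1 -> 0 < Q -> (2 * t)^-1 * logp Q <= c%:R ->
  Q * (1 - t) ^+ c ^+ 2 <= 1.
Proof.
move=> /andP[t0 t1] Q0; rewrite mulrC ler_pdivrMr ?mulr_gt0// => h.
have lnQ : ln Q <= c%:R * (2 * t) by apply: le_trans h; rewrite /logp le_max lexx.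
have e1 : (1 - t) ^+ c <= expR (- t *+ c).
  rewrite -mulr_natr expRM_natr.
  by apply: lerXn2r; rewrite ?nnegrE ?expR_ge0 ?subr_ge0 ?(ltW t1)// expR_ge1Dx.
have QE : Q <= expR (t *+ c) ^+ 2.
  rewrite -ler_ln ?posrE ?exprn_gt0 ?expR_gt0// -expRM_natr expRK.
  by apply: le_trans lnQ _; rewrite -mulr_natr; lra.
have p0 : 0 <= (1 - t) ^+ c by rewrite exprn_ge0// subr_ge0 ltW.
apply: (@le_trans _ _ (expR (t *+ c) ^+ 2 * expR (- t *+ c) ^+ 2)).
  by rewrite ler_pM ?sqr_ge0 ?(ltW Q0)// ler_pXn2r// nnegrE ?expR_ge0.
by rewrite -exprMn -expRD mulNrn subrr expR0 expr1n.
Qed.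

Lemma ceil_natr (R : realType) (t : R) : 0 <= t ->
  exists2 n : nat, (Num.ceil t)%:~R = n%:R :> R & t <= n%:R.
Proof.
move=> t0; have c0 : 0 <= Num.ceil t by rewrite -(ler_int R) (le_trans t0)// ceil_ge.
have e : (Num.ceil t)%:~R = `|Num.ceil t|%N%:R :> R by rewrite -[LHS]/(_%:~R) -{1}(gez0_abs c0).
by exists `|Num.ceil t|%N => //; rewrite -e ceil_ge.
Qed.

Lemma powR_third_cube (R : realType) (a : R) : 0 <= a -> (a `^ 3^-1) ^+ 3 = a.
Proof. by move=> a0; rewrite -powR_mulrn ?powR_ge0// -powRrM mulVf// powRr1. Qed.

Lemma powR_two_thirds_cube (R : realType) (a : R) :
  0 <= a -> (a `^ (2 / 3)) ^+ 3 = a ^+ 2.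
Proof.
move=> a0; rewrite -powR_mulrn ?powR_ge0// -powRrM divfK//.
by rewrite powR_mulrn.
Qed.

(** Cubing removes every fractional exponent and leaves a polynomial inequality. The two ergodic
    bounds are instances, differing in [w] (a power of [1 - sigma ^+ 2]) and in [q] ([d0 ^+ 2] or
    [d0 ^+ 3]). *)
Lemma le_cube_of_powR_le (R : realType) (t e w q r A : R) :
  0 < t -> 0 < e -> 0 < w -> 0 <= q -> 0 < r ->
  2 * 4 `^ 3^-1 / (t * e `^ (2 / 3) * w) * (q / r) `^ (2 / 3) <= 2 * A ->
  4 * q ^+ 2 <= A ^+ 3 * t ^+ 3 * e ^+ 2 * w ^+ 3 * r ^+ 2.
Proof.
move=> t0 e0 w0 q0 r0.
have qr0 : 0 <= q / r by rewrite divr_ge0// ltW.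
have e30 : 0 < e `^ (2 / 3) by exact: powR_gt0.
have d0 : 0 < t * e `^ (2 / 3) * w by rewrite !mulr_gt0.
rewrite mulrAC ler_pdivrMr// -!mulrA ler_pM2l// => h.
have h0 : 0 <= 4 `^ 3^-1 * (q / r) `^ (2 / 3) by rewrite mulr_ge0// powR_ge0.
have := lerXn2r 3 h0 (le_trans h0 h) h.
rewrite !exprMn powR_third_cube// !powR_two_thirds_cube ?(ltW e0)//.
move=> h3; have -> : 4 * q ^+ 2 = 4 * (q / r) ^+ 2 * r ^+ 2.
  by field; rewrite gt_eqF.
by have := ler_wpM2r (sqr_ge0 r) h3; lra.
Qed.

Lemma big_nat1_recr (V : nmodType) (P : pred nat) (f : nat -> V) (m : nat) :
  \sum_(1 <= k < m.+2 | P k) f k =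
  \sum_(1 <= k < m.+1 | P k) f k + (if P m.+1 then f m.+1 else 0).
Proof. by rewrite big_mkcond big_nat_recr//= -big_mkcond. Qed.

(** No nearest solution is chosen: estimates are proved against every solution and then passed to
    the infimum. *)
Lemma le_dist_to (R : realType) (H : completeNormedModType R) (S : set H)
    (x0 : H) (c : R) :
  S !=set0 -> (forall z, S z -> c <= `|x0 - z|) -> c <= dist_to S x0.
Proof.
move=> [z Sz] h; apply: lb_le_inf; first by exists `|x0 - z|, z.
by move=> _ [w Sw <-]; exact: h.
Qed.

Lemma dist_to_ge0 (R : realType) (H : completeNormedModType R) (S : set H)
    (x0 : H) : S !=set0 -> 0 <= dist_to S x0.
Proof. by move=> S0; exact: le_dist_to. Qed.

Lemma le_sqr_dist_to (R : realType) (H : completeNormedModType R) (S : set H)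
    (x0 : H) (c : R) :
  S !=set0 -> (forall z, S z -> c <= `|x0 - z| ^+ 2) ->
  c <= dist_to S x0 ^+ 2.
Proof.
move=> S0 h; have [c0|c0] := leP 0 c; last first.
  by rewrite (le_trans (ltW c0))// sqr_ge0.
rewrite -(sqr_sqrtr c0) ler_pXn2r// ?nnegrE ?sqrtr_ge0 ?dist_to_ge0//.
apply: le_dist_to => // z /h.
by rewrite -{1}(sqr_sqrtr c0) ler_pXn2r// nnegrE ?sqrtr_ge0.
Qed.

(** * Runs of Algorithm 2 *)

Section Run.
Variables (R : realType) (H : completeNormedModType R).
Variables (ip : H -> H -> R) (C : set H) (F : H -> H) (F' : H -> H -> H).
Variables (L sh th eta lam1 : R) (x0 : H).
Variables (x y nu : nat -> H) (lam : nat -> R).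
Hypotheses (ipP : is_inner_product ip) (convC : convex_set C).
Hypotheses (monF : monotone_on ip C F) (dF : derivative_on C F F').
Hypotheses (L0 : 0 < L) (lipF' : lipschitz_deriv_on C F' L).
Hypotheses (sh0 : 0 <= sh) (sh12 : sh < 1 / 2) (th0 : 0 < th).
Hypothesis th_lt : th < (1 - sh) * (1 - 2 * sh).
Hypothesis eta_gt : 2 * thetah sh th / L < eta.
Hypotheses (Cx0 : C x0) (lam10 : 0 < lam1).
Hypothesis lam1_le : lam1 ^+ 2 * `|F x0| <= 2 * th / L.
Hypothesis run : alg2_run ip C F F' L sh th eta lam1 x0 x y nu lam.
Local Notation thh := (thetah sh th).
Local Notation tau := (tau_of sh th eta L).
Local Notation sigma := (2 * thh / (eta * L)).
Local Notation succ := (succ_it eta x y lam).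
Local Notation v k := (F (y k) + nu k).
Local Notation sol := [set z | FNC ip C F z 0].

Let tau_gt0 : 0 < tau. Proof. exact: tau_gt0. Qed.
Let tau_lt1 : tau < 1. Proof. exact: tau_lt1. Qed.
Let thh_gt0 : 0 < thh. Proof. exact: thetah_gt0. Qed.
Let thh_lt : thh < th. Proof. exact: thetah_lt. Qed.
Let tau_root : th * (1 - tau) ^+ 2 = thh + tau * (eta * L / 2).
Proof. exact: tau_root. Qed.
Let eta_gt0 : 0 < eta. Proof. exact: eta_gt0 eta_gt. Qed.
Let sigma_lt1 : sigma < 1. Proof. exact: sigma_lt1. Qed.
Let sigma_gt0 : 0 < sigma. Proof. exact: sigma_gt0. Qed.
Let omt : 0 < 1 - tau. Proof. by have := tau_lt1; lra. Qed.
Let oms : 0 < 1 - sigma ^+ 2.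
Proof. by have := sigma_lt1; have := sigma_gt0; nra. Qed.

Lemma run_update k :
  if succ k.+1 then
    x k.+1 = x k - (tau * lam k.+1) *: v k.+1 /\ lam k.+2 = (1 - tau) * lam k.+1
  else x k.+1 = x k /\ lam k.+2 = lam k.+1 / (1 - tau).
Proof.
case: run => _ _ _ _ /(_ k.+1 isT)[_] /=; rewrite /succ_it /=.
by case=> -[]; case: ifP.
Qed.

(** The state on entry to iteration [k.+1], so the iterates of index [k] are paired with the
    stepsize about to be used. *)
Let inv k := [/\ normal_cone ip C (y k) (nu k), 0 < lam k.+1 &
  lam k.+1 * L / 2 * `|lam k.+1 *: v k + y k - x k| <= th].

Let newton k : inv k -> normal_cone ip C (y k.+1) (nu k.+1) /\
  lam k.+1 * L / 2 * `|lam k.+1 *: v k.+1 + y k.+1 - x k| <= thh.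
Proof.
move=> [N l0 hr]; case: run => _ _ _ _ /(_ k.+1 isT)[+ _] /=.
case=> [[h [-> ->]]|[_ [N' h]]]; first by split.
split=> //; apply: (newton_step ipP convC monF dF lipF' L0 sh0 _ l0 N N' hr h).
by have := sh12; lra.
Qed.

Lemma run_invariant k : inv k.
Proof.
elim: k => [|k /[dup] /newton[N hr] [_ l0 _]].
  case: run => x_0 y_0 nu_0 lam_1 _; rewrite /inv x_0 y_0 nu_0 lam_1; split=> //.
    by split=> // z _; rewrite (ip0l ipP).
  rewrite addr0 addrK normrZ gtr0_norm//.
  by move: lam1_le; rewrite ler_pdivlMr//; lra.
have := run_update k; case: ifP => [_|/negbT ns] [xE lE]; split=> //.
- by rewrite lE mulr_gt0.
(* After a large step the changes in [lam] and in [x] cancel inside the residual vector; only the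
   factor in front shrinks. *)
- rewrite lE xE (_ : _ - (_ - _) = lam k.+1 *: v k.+1 + y k.+1 - x k).
    set q := lam k.+1 * L / 2 * _ in hr.
    rewrite [leLHS](_ : _ = (1 - tau) * q); last by rewrite /q; ring.
    have q0 : 0 <= q by rewrite mulr_ge0// ltW// divr_gt0// mulr_gt0.
    by have := tau_gt0; have := thh_lt; nra.
  by apply: (ip_inj ipP) => w; rewrite !(ipEl ipP); ring.
- by rewrite lE divr_gt0.
- rewrite lE xE.
  have lt_eta : lam k.+1 * `|y k.+1 - x k| < eta by rewrite ltNge.
  (* After a small step the new residual is an inflated [r - tau (y - x)], so the bound becomes
     [(thh + tau eta L / 2) / (1 - tau)^2], which [tau_root] identifies with [th]. *)
  have -> : (lam k.+1 / (1 - tau)) *: v k.+1 + y k.+1 - x k =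
      (1 - tau)^-1 *: ((lam k.+1 *: v k.+1 + y k.+1 - x k) - tau *: (y k.+1 - x k)).
    by apply: (ip_inj ipP) => w; rewrite !(ipEl ipP); field; rewrite gt_eqF.
  rewrite normrZ normfV (gtr0_norm omt).
  set r := lam k.+1 *: v k.+1 + y k.+1 - x k in hr *.
  have h : `|r - tau *: (y k.+1 - x k)| <= `|r| + tau * `|y k.+1 - x k|.
    by apply: le_trans (ler_normB _ _) _; rewrite normrZ (gtr0_norm tau_gt0).
  set n := `|r - _| in h *.
  rewrite [leLHS](_ : _ = lam k.+1 * L / 2 * n / (1 - tau) ^+ 2); last first.
    by field; rewrite gt_eqF.
  rewrite ler_pdivrMr ?exprn_gt0// tau_root.
  have q0 : 0 < lam k.+1 * L / 2 by rewrite divr_gt0 ?mulr_gt0.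
  apply: le_trans (ler_wpM2l (ltW q0) h) _; rewrite mulrDr; apply: lerD => //.
  rewrite mulrCA ler_pM2l// mulrAC ler_pM2r ?invr_gt0// mulrAC ler_pM2r//.
  exact: ltW.
Qed.

Lemma run_normal k : normal_cone ip C (y k) (nu k).
Proof. by case: (run_invariant k). Qed.

Lemma run_stepsize_gt0 k : 0 < lam k.+1.
Proof. by case: (run_invariant k). Qed.

Lemma run_residual k :
  lam k.+1 * L / 2 * `|lam k.+1 *: v k.+1 + y k.+1 - x k| <= thh.
Proof. by case: (newton (run_invariant k)). Qed.

(** Multiply [|r| <= 2 thh / (lam L)] by [1 <= lam |y - x| / eta]. *)
Lemma large_step_residual k : succ k.+1 ->
  `|lam k.+1 *: v k.+1 + y k.+1 - x k| <= sigma * `|y k.+1 - x k|.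
Proof.
rewrite /succ_it /= => hs; have := run_residual k; have l0 := run_stepsize_gt0 k.
set r := `|_|; set a := `|_| in hs * => hr.
rewrite mulrAC ler_pdivlMr ?mulr_gt0//.
have : 0 <= r by exact: normr_ge0.
have : 0 <= a by exact: normr_ge0.
move=> a0 r0.
have h1 : eta * (L / 2 * r) <= lam k.+1 * a * (L / 2 * r).
  by rewrite ler_wpM2r// mulr_ge0// divr_ge0// ltW.
have h2 : a * (lam k.+1 * L / 2 * r) <= a * thh by rewrite ler_wpM2l.
lra.
Qed.

(** The point [z] is arbitrary: solutions give Fejer monotonicity, while [epsbar_le] takes [z] to be
    the ergodic mean. *)
Lemma fejer_sum m z :
  `|x m - z| ^+ 2 +
  2 * tau * \sum_(1 <= k < m.+1 | succ k) (lam k * ip (v k) (y k - z)) +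
  tau * (1 - sigma ^+ 2) * \sum_(1 <= k < m.+1 | succ k) `|y k - x k.-1| ^+ 2
  <= `|x0 - z| ^+ 2.
Proof.
elim: m => [|m IH].
  by rewrite !big_geq// !mulr0 !addr0; case: run => ->.
rewrite !big_nat1_recr; have := run_update m.
case: ifP => [hs [xE _]|_ [-> _]]; last by rewrite !addr0.
have := relaxed_hpe_step ipP z (run_stepsize_gt0 m) (ltW sigma_gt0) _
  (large_step_residual hs) (tau := tau).
rewrite -xE tau_gt0 tau_lt1 => /(_ isT) h.
by rewrite !mulrDr /=; lra.
Qed.

Lemma solution_monotone z k : sol z -> 0 <= ip (v k) (y k - z).
Proof.
case=> mu Nz e; rewrite -[v k]subr0 -e.
exact: FNC_monotone (run_normal k) Nz.
Qed.

Lemma fejer_solution m z : sol z ->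
  `|x m - z| ^+ 2 +
  tau * (1 - sigma ^+ 2) * \sum_(1 <= k < m.+1 | succ k) `|y k - x k.-1| ^+ 2
  <= `|x0 - z| ^+ 2.
Proof.
move=> Sz; apply: le_trans (fejer_sum m z); rewrite lerD2r lerDl.
apply: mulr_ge0; first by rewrite mulr_ge0// ltW.
rewrite big_nat_cond; apply: sumr_ge0 => -[|k] // _.
by rewrite mulr_ge0 ?solution_monotone// ltW// run_stepsize_gt0.
Qed.

Lemma iterate_dist_le m z : sol z -> `|x m - z| <= `|x0 - z|.
Proof.
move=> /(fejer_solution m) h; rewrite -(ler_pXn2r (ltn0Sn 1)) ?nnegrE//.
apply: le_trans h; rewrite lerDl; apply: mulr_ge0; first by rewrite mulr_ge0// ltW.
by apply: sumr_ge0 => k _; exact: sqr_ge0.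
Qed.

Lemma displacement_sum m :
  x0 - x m = tau *: \sum_(1 <= k < m.+1 | succ k) (lam k *: v k).
Proof.
elim: m => [|m IH]; first by rewrite big_geq// scaler0; case: run => ->; rewrite subrr.
rewrite big_nat1_recr scalerDr -IH; have := run_update m.
case: ifP => [_ [-> _]|_ [-> _]]; last by rewrite scaler0 addr0.
by rewrite opprB scalerA addrA addrAC.
Qed.

(* If [x0] solves the problem, the Newton inequality forces [y k = x0], so either [v k = 0]
   or nothing moves and [lam] grows geometrically, against [run_invariant]. *)
Lemma dist_to_solution_gt0 :
  sol !=set0 -> (forall k, v k != 0) -> 0 < dist_to sol x0.
Proof.
move=> S0 nz; rewrite ltNge; apply/negP => d_le0.
have close e : 0 < e -> exists2 z, sol z & `|x0 - z| < e.
  move=> e0; apply: contrapT => h.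
  suff : e <= dist_to sol x0 by lra.
  by apply: le_dist_to => // z Sz; rewrite leNgt; apply/negP => lt; apply: h; exists z.
(* Zero distance only provides solutions arbitrarily near [x0]; the variational inequality reaches
   [x0] by continuity of [F]. *)
have x0_sol c : C c -> 0 <= ip (F x0) (c - x0).
  move=> Cc; rewrite leNgt; apply/negP => q0.
  have [_ [M hM] /(_ 1 ltr01)[d [d0 hd]]] := dF Cx0.
  (* For [z] near [x0], passing from [<F z, c - z>] to [<F x0, c - x0>] costs at most [K |x0 - z|]:
     [1 + |M|] bounds the growth of [F] at [x0], and [|c - z| <= |c - x0| + 1]. *)
  pose K := (1 + `|M|) * (`|c - x0| + 1) + `|F x0|.
  have K0 : 0 <= K by rewrite addr_ge0// mulr_ge0// addr_ge0.
  have [|z [mu [Cz Nz] e] zx] := close (Num.min 1 (Num.min d (- ip (F x0) (c - x0) / (K + 1)))).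
    by rewrite !lt_min ltr01 d0 divr_gt0 ?oppr_gt0// ltr_wpDl.
  move: zx; rewrite !lt_min ltr_pdivlMr ?ltr_wpDl// => /and3P[z1 zd zK].
  have n0 := normr_ge0 (x0 - z).
  have ipz : 0 <= ip (F z) (c - z).
    have := Nz _ Cc; have -> : mu = - F z by apply/eqP; rewrite -addr_eq0 addrC e.
    by rewrite (ipNl ipP); lra.
  have dist : `|F x0 - F z| <= (1 + `|M|) * `|x0 - z|.
    have := hd _ Cz; rewrite distrC => /(_ zd) h1; have := hM (z - x0).
    rewrite distrC => h2.
    have -> : F x0 - F z = - ((F z - F x0 - F' x0 (z - x0)) + F' x0 (z - x0)).
      by rewrite subrK opprB.
    rewrite normrN; apply: le_trans (ler_normD _ _) _.
    have : M * `|x0 - z| <= `|M| * `|x0 - z| by rewrite ler_wpM2r// ler_norm.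
    lra.
  have cz : `|c - z| <= `|c - x0| + 1.
    rewrite -(subrK x0 c) -addrA; apply: le_trans (ler_normD _ _) _.
    by rewrite subrK lerD2l ltW.
  have i1 := ip_norm_le ipP (F x0 - F z) (c - z).
  have i2 := ip_norm_le ipP (F x0) (z - x0); rewrite distrC in i2.
  have i3 : `|F x0 - F z| * `|c - z| <= (1 + `|M|) * `|x0 - z| * (`|c - x0| + 1).
    by rewrite ler_pM.
  have split_ip : ip (F x0) (c - x0) =
      ip (F z) (c - z) + ip (F x0 - F z) (c - z) + ip (F x0) (z - x0).
    by rewrite !(ipE ipP); ring.
  move: i1 i2; rewrite !ler_norml => /andP[i1 _] /andP[i2 _].
  by rewrite /K in zK; lra.
(* A linear lower bound on the growing stepsize suffices; its induction step is
   [1 + (k + 1) t <= (1 + k t) / (1 - t)]. *)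
have stuck k : [/\ x k = x0, y k = x0, nu k = 0 & lam1 * (1 + k%:R * tau) <= lam k.+1].
  elim: k => [|k [xE yE nuE lE]].
    by case: run => -> -> -> -> _; split=> //; rewrite mul0r addr0 mulr1.
  have l0 := run_stepsize_gt0 k.
  have [yE1 nuE1] : y k.+1 = x0 /\ nu k.+1 = 0.
    case: run => _ _ _ _ /(_ k.+1 isT)[+ _] /=.
    case=> [[_ [-> ->]]//|[_ [[Cy' Ny'] h]]].
    rewrite xE yE /Flin -addrA in h.
    set d := y k.+1 - x0 in h.
    have psd := deriv_monotone ipP convC monF dF Cx0 Cy'.
    have n1 := x0_sol _ Cy'; have := Ny' _ Cx0.
    rewrite -opprB (ipNr ipP) -/d => n2.
    have i1 := ip_le ipP (lam k.+1 *: (F x0 + F' x0 d + nu k.+1) + d) d.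
    have i2 : `|d| ^+ 2 <= ip (lam k.+1 *: (F x0 + F' x0 d + nu k.+1) + d) d.
      rewrite (ipDl ipP _ d) (ip_sqr ipP) lerDr (ipZl ipP) mulr_ge0 ?(ltW l0)//.
      by rewrite !(ipDl ipP) -/d in psd n1 *; lra.
    have d0 : d = 0.
      apply/eqP; rewrite -normr_le0 leNgt; apply/negP => dp.
      have := ler_wpM2r (normr_ge0 d) h; have := sh12; nra.
    have : F x0 + nu k.+1 = 0.
      rewrite d0 normr0 mulr0 (_ : F' x0 0 = 0) ?addr0 in h; last first.
        by rewrite -(scale0r 0) (deriv_lin dF) ?scale0r.
      by move: h; rewrite normr_le0 scaler_eq0 (gt_eqF l0) => /eqP.
    have yx : y k.+1 = x0 by apply/eqP; rewrite -subr_eq0 -/d d0.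
    by rewrite -{1}yx => /eqP; rewrite (negPf (nz k.+1)).
  have := run_update k; rewrite /succ_it /= yE1 xE subrr normr0 mulr0.
  rewrite leNgt eta_gt0 /= => -[-> ->]; split=> //.
  rewrite ler_pdivlMr//; apply: le_trans lE; rewrite -mulrA ler_pM2l//.
  by have := sqr_ge0 tau; rewrite -natr1; have := mulr_ge0 (ler0n R k) (sqr_ge0 tau); lra.
have F0 : 0 < `|F x0|.
  by rewrite normr_gt0; have := nz 0%N; case: run => _ -> -> _ _; rewrite addr0.
(* With the stepsize at least [lam1 (1 + k tau)], the invariant's left side at index [k] exceeds
   [k c]; an integer [k > th / c] contradicts it. *)
pose c := lam1 ^+ 2 * tau * `|F x0| * L / 2.
have c0 : 0 < c.
  apply: divr_gt0 => //; apply: mulr_gt0 L0; apply: mulr_gt0 F0.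
  by apply: mulr_gt0 tau_gt0; apply: exprn_gt0.
have := archi_boundP (divr_ge0 (ltW th0) (ltW c0)).
set k := Num.bound _; rewrite ltr_pdivrMr// => hk.
have [_ l0 ] := run_invariant k; have [-> -> -> lk] := stuck k.
rewrite addr0 addrK normrZ (gtr0_norm l0) => hth.
have : lam1 * (1 + k%:R * tau) * lam1 <= lam k.+1 * lam k.+1.
  have k1 : 0 <= k%:R * tau := mulr_ge0 (ler0n R k) (ltW tau_gt0).
  apply: (ler_pM _ _ lk); first by rewrite mulr_ge0 ?(ltW lam10)// addr_ge0.
    exact: ltW.
  by apply: le_trans lk; rewrite ler_peMr ?(ltW lam10)// lerDl.
have q0 : 0 < L / 2 * `|F x0| by rewrite mulr_gt0// divr_gt0.
rewrite -(ler_pM2r q0) => hll.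
have := mulr_gt0 (exprn_gt0 2 lam10) q0.
rewrite /c in hk; lra.
Qed.

(** * Counting large and small steps *)

Definition nsucc m := count succ (iota 1 m).
Definition nfail m := count (predC succ) (iota 1 m).

Lemma nsuccS m : nsucc m.+1 = (nsucc m + succ m.+1)%N.
Proof. by rewrite /nsucc -(addn1 m) iotaD count_cat /= addn0 add1n addn1. Qed.

Lemma nfailS m : nfail m.+1 = (nfail m + ~~ succ m.+1)%N.
Proof. by rewrite /nfail -(addn1 m) iotaD count_cat /= addn0 add1n addn1. Qed.

Lemma nsuccDnfail m : (nsucc m + nfail m)%N = m.
Proof. by rewrite /nsucc /nfail count_predC size_iota. Qed.

Lemma natr_nsucc m : (nsucc m)%:R = \sum_(1 <= k < m.+1 | succ k) (1 : R).
Proof.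
elim: m => [|m IH]; first by rewrite big_geq.
by rewrite nsuccS natrD IH big_nat1_recr; case: ifP.
Qed.

Lemma nsucc_gt0 m : (0 < nsucc m)%N -> exists k, (1 <= k <= m)%N /\ succ k.
Proof.
rewrite -has_count => /hasP[k]; rewrite mem_iota add1n ltnS => km sk.
by exists k.
Qed.

(** Both counts stay as exponents on opposite sides to avoid negative powers. *)
Lemma stepsizeE m : lam m.+1 * (1 - tau) ^+ nfail m = lam1 * (1 - tau) ^+ nsucc m.
Proof.
elim: m => [|m IH]; first by case: run => _ _ _ -> _.
rewrite nsuccS nfailS; have := run_update m; case: ifP => _ [_ ->] /=.
  by rewrite addn0 addn1 exprSr mulrA -IH; ring.
by rewrite addn0 addn1 exprS -IH; field; rewrite gt_eqF.
Qed.

(* Each non-large step multiplies the stepsize by 1 / (1 - tau), and at such a step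
   [lam k ^+ 2 * `|v k| < eta + 2 * thh / L]: a large residual forces a small stepsize. *)
Lemma nfail_le rho M c : 0 < rho ->
  (forall k, (1 <= k <= M)%N -> rho < `|v k|) ->
  (eta + 2 * thh / L) / (lam1 ^+ 2 * rho) * (1 - tau) ^+ c ^+ 2 <= 1 ->
  (nfail M <= nsucc M + c)%N.
Proof.
move=> rho0 + cP; elim: M => [//|M IH] hv.
have {}IH : (nfail M <= nsucc M + c)%N.
  by apply: IH => k /andP[k1 kM]; apply: hv; rewrite k1 leqW.
rewrite nfailS nsuccS; have [_|ns] /= := boolP (succ M.+1).
  by rewrite addn0 addn1 addSn leqW.
rewrite addn0 addn1 ltnNge; apply/negP => le_nfail.
have l0 := run_stepsize_gt0 M; have := run_residual M.
move: ns; rewrite /succ_it /= -ltNge => la hr.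
have rho_lt : rho < `|v M.+1| by apply: hv; rewrite leqnn.
set p := (1 - tau) ^+ c in cP.
have p0 : 0 < p by exact: exprn_gt0.
(* If the count fails here, small steps already lead large ones by [c], so [stepsizeE] forces a
   large stepsize. *)
have lam1_lep : lam1 <= lam M.+1 * p.
  have pA0 : 0 < (1 - tau) ^+ nsucc M by exact: exprn_gt0.
  rewrite -(ler_pM2r pA0) -stepsizeE -mulrA ler_pM2l// /p mulrC -exprD.
  by apply: ler_wiXn2l => //; [exact: ltW | rewrite gerBl ltW].
set q := eta + 2 * thh / L in cP.
(* From [lam |v| <= |r| + |y - x|], multiplied by [lam]: the residual contributes [2 thh / L], the
   small step less than [eta]. *)
have lv : lam M.+1 ^+ 2 * `|v M.+1| < q.
  set r := lam M.+1 *: v M.+1 + y M.+1 - x M in hr.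
  have lvE : lam M.+1 * `|v M.+1| = `|r - (y M.+1 - x M)|.
    rewrite -(gtr0_norm l0) -normrZ; congr `|_|.
    by apply: (ip_inj ipP) => w; rewrite /r !(ipEl ipP); ring.
  have : lam M.+1 * `|v M.+1| <= `|r| + `|y M.+1 - x M| by rewrite lvE ler_normB.
  move=> h; have := ler_wpM2l (ltW l0) h.
  have : lam M.+1 * `|r| <= 2 * thh / L by rewrite ler_pdivlMr//; lra.
  rewrite /q; lra.
have q0 : 0 < lam1 ^+ 2 * rho by rewrite mulr_gt0// exprn_gt0.
move: cP; rewrite mulrAC ler_pdivrMr// mul1r => cP.
have h1 : lam1 ^+ 2 <= (lam M.+1 * p) ^+ 2.
  by rewrite ler_pXn2r// nnegrE ltW// mulr_gt0.
have h2 : lam1 ^+ 2 * rho <= (lam M.+1 * p) ^+ 2 * rho by rewrite ler_pM2r.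
have h3 : lam M.+1 ^+ 2 * rho < q.
  by apply: lt_trans lv; rewrite ltr_pM2l// exprn_gt0.
have : lam M.+1 ^+ 2 * rho * p ^+ 2 < q * p ^+ 2 by rewrite ltr_pM2r// exprn_gt0.
by rewrite exprMn in h2; lra.
Qed.

Lemma sum_sqr_steps_le M : sol !=set0 ->
  tau * (1 - sigma ^+ 2) * \sum_(1 <= k < M.+1 | succ k) `|y k - x k.-1| ^+ 2
  <= dist_to sol x0 ^+ 2.
Proof.
move=> S0; apply: le_sqr_dist_to => // z Sz.
by apply: le_trans (fejer_solution M Sz); rewrite lerDr sqr_ge0.
Qed.

(** At a large step [eta |v| <= lam |v| |y - x| <= (1 + sigma) |y - x|^2]; the factor [1 + sigma]
    cancels against [1 - sigma^2]. *)
Lemma sum_norm_le M : sol !=set0 ->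
  tau * eta * (1 - sigma) * \sum_(1 <= k < M.+1 | succ k) `|v k|
  <= dist_to sol x0 ^+ 2.
Proof.
move=> S0; apply: le_trans (sum_sqr_steps_le M S0).
have oms1 : 0 < 1 - sigma by rewrite subr_gt0.
have -> : tau * eta * (1 - sigma) * \sum_(1 <= k < M.+1 | succ k) `|v k| =
    tau * (1 - sigma) * (eta * \sum_(1 <= k < M.+1 | succ k) `|v k|) by ring.
set S := \sum_(1 <= k < M.+1 | succ k) `|y k - x k.-1| ^+ 2.
have -> : tau * (1 - sigma ^+ 2) * S = tau * (1 - sigma) * ((1 + sigma) * S) by ring.
rewrite ler_pM2l; last exact: mulr_gt0.
rewrite !mulr_sumr big_nat_cond [leRHS]big_nat_cond; apply: ler_sum => -[|k]//.
move=> /andP[_ hs]; have hr := large_step_residual hs; have l0 := run_stepsize_gt0 k.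
move: hs; rewrite /succ_it /= => hs.
move=> /=; set a := `|y k.+1 - x k| in hr hs *; set r := lam k.+1 *: v k.+1 + y k.+1 - x k in hr.
have lvE : lam k.+1 * `|v k.+1| = `|r - (y k.+1 - x k)|.
  rewrite -(gtr0_norm l0) -normrZ; congr `|_|.
  by apply: (ip_inj ipP) => w; rewrite /r !(ipEl ipP); ring.
have h1 : lam k.+1 * `|v k.+1| <= (1 + sigma) * a.
  by rewrite lvE; apply: le_trans (ler_normB _ _) _; rewrite -/a; lra.
have h2 := ler_wpM2r (normr_ge0 (v k.+1)) hs.
have a0 : 0 <= a by exact: normr_ge0.
by have h3 := ler_wpM2l a0 h1; rewrite expr2; lra.
Qed.

(** Strictness is what the ceiling demands. It comes from [rho < |v k|] when there is a large step,
    and from a positive distance when there is none. *)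
Lemma nsucc_lt rho M : sol !=set0 -> (forall k, v k != 0) -> 0 < rho ->
  (forall k, (1 <= k <= M)%N -> rho < `|v k|) ->
  (nsucc M)%:R < (tau * eta * (1 - sigma))^-1 * (dist_to sol x0 ^+ 2 / rho).
Proof.
move=> S0 nz rho0 hv; have d0 := dist_to_solution_gt0 S0 nz.
have K0 : 0 < tau * eta * (1 - sigma).
  by apply: mulr_gt0; [exact: mulr_gt0|rewrite subr_gt0].
rewrite mulrC ltr_pdivlMr// ltr_pdivlMr//.
have [nM|nM] := posnP (nsucc M); first by rewrite nM !mul0r exprn_gt0.
apply: lt_le_trans (sum_norm_le M S0).
rewrite mulrAC [_ * (tau * _ * _)]mulrC ltr_pM2l//.
have : forall m, (m <= M)%N -> (0 < nsucc m)%N ->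
    (nsucc m)%:R * rho < \sum_(1 <= k < m.+1 | succ k) `|v k|; last exact.
elim=> [//|m IH] mM; rewrite nsuccS big_nat1_recr; case: ifP => _; last first.
  by rewrite addn0 addr0; apply: IH; exact: ltnW.
rewrite addn1 -natr1 mulrDl mul1r => _; rewrite ler_ltD ?hv//.
have [->|n0] := posnP (nsucc m); first by rewrite mul0r sumr_ge0.
by apply: ltW; apply: IH => //; exact: ltnW.
Qed.

(** * Ergodic averages *)

Local Notation Lam m := (Lam_sum eta x y lam m).
Local Notation yb m := (ybar eta x y lam m).
Local Notation vb m := (vbar F eta x y nu lam m).
Local Notation eps m := (epsbar ip F eta x y nu lam m).

Lemma Lam_sum_gt0 m : (0 < nsucc m)%N -> 0 < Lam m.
Proof.
elim: m => [//|m IH]; rewrite nsuccS /Lam_sum big_nat1_recr.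
case: ifP => _; last by rewrite addn0 addr0.
move=> _; apply: ltr_wpDl (run_stepsize_gt0 m).
by rewrite big_nat_cond; apply: sumr_ge0 => -[|k]// _; rewrite ltW ?run_stepsize_gt0.
Qed.

(** The stepsize sum grows at least like the [3/2] power of the number of large steps, whence the
    exponent [2/3] in the ergodic bound. *)
Lemma Lam_sum_ge m : sol !=set0 ->
  (nsucc m)%:R ^+ 3 * eta ^+ 2 * (tau * (1 - sigma ^+ 2)) <=
  Lam m ^+ 2 * dist_to sol x0 ^+ 2.
Proof.
move=> S0; have tos : 0 < tau * (1 - sigma ^+ 2) by exact: mulr_gt0.
have h : (nsucc m)%:R ^+ 3 * eta ^+ 2 <=
    Lam m ^+ 2 * \sum_(1 <= k < m.+1 | succ k) `|y k - x k.-1| ^+ 2.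
  rewrite natr_nsucc /Lam_sum !(big_nat_cond _ _ _ _ succ).
  apply: sum_large_steps => // -[|k] /andP[//]; rewrite /succ_it /= => _ hk.
  by split=> //; exact: run_stepsize_gt0.
apply: le_trans (ler_wpM2r (ltW tos) h) _.
rewrite -[leLHS]mulrA; apply: ler_wpM2l; first exact: sqr_ge0.
by rewrite mulrC; exact: sum_sqr_steps_le.
Qed.

Section Averages.
Variable m : nat.
Hypothesis succ_m : (0 < nsucc m)%N.

Let Lam0 : 0 < Lam m. Proof. exact: Lam_sum_gt0. Qed.

Lemma scale_ybar : Lam m *: yb m = \sum_(1 <= k < m.+1 | succ k) (lam k *: y k).
Proof. by rewrite /ybar scalerA divff ?gt_eqF// scale1r. Qed.

Lemma scale_vbar : Lam m *: vb m = \sum_(1 <= k < m.+1 | succ k) (lam k *: v k).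
Proof. by rewrite /vbar scalerA divff ?gt_eqF// scale1r. Qed.

(** A covariance decomposition around the weighted means: the cross terms vanish because deviations
    from a mean sum to zero. *)
Lemma weighted_ip_sum w u :
  \sum_(1 <= k < m.+1 | succ k) (lam k * ip (y k - w) (v k - u)) =
  Lam m * (eps m + ip (yb m - w) (vb m - u)).
Proof.
have y0 : \sum_(1 <= k < m.+1 | succ k) lam k *: (y k - yb m) = 0.
  under eq_bigr do rewrite scalerBr.
  by rewrite sumrB -scaler_suml -scale_ybar subrr.
have v0 : \sum_(1 <= k < m.+1 | succ k) lam k *: (v k - vb m) = 0.
  under eq_bigr do rewrite scalerBr.
  by rewrite sumrB -scaler_suml -scale_vbar subrr.
have -> : \sum_(1 <= k < m.+1 | succ k) (lam k * ip (y k - w) (v k - u)) =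
    \sum_(1 <= k < m.+1 | succ k) (lam k * ip (y k - yb m) (v k - vb m)) +
    \sum_(1 <= k < m.+1 | succ k) ip (lam k *: (y k - yb m)) (vb m - u) +
    \sum_(1 <= k < m.+1 | succ k) ip (lam k *: (v k - vb m)) (yb m - w) +
    \sum_(1 <= k < m.+1 | succ k) lam k * ip (yb m - w) (vb m - u).
  rewrite -!big_split /=; apply: eq_bigr => k _.
  rewrite !(ipZl ipP) -!mulrDr; congr (_ * _).
  have -> : y k - w = (y k - yb m) + (yb m - w) by rewrite addrA subrK.
  have -> : v k - u = (v k - vb m) + (vb m - u) by rewrite addrA subrK.
  move: (y k - yb m) (yb m - w) (v k - vb m) (vb m - u) => a b c d.
  by rewrite !(ipE ipP) (ipC ipP c b); ring.
rewrite -!(ip_suml ipP) y0 v0 !(ip0l ipP) !addr0 -mulr_suml mulrDr; congr (_ + _).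
by rewrite /epsbar mulrA divff ?gt_eqF// mul1r.
Qed.

Lemma vbar_enlargement : enlargement ip (FNC ip C F) (eps m) (yb m) (vb m).
Proof.
move=> z _ [mu Nz <-]; rewrite (ipC ipP) -subr_ge0 opprK addrC.
rewrite -(pmulr_rge0 _ Lam0) -weighted_ip_sum big_nat_cond.
apply: sumr_ge0 => -[|k]// _; rewrite mulr_ge0 ?(ltW (run_stepsize_gt0 k))//.
by rewrite (ipC ipP); exact: FNC_monotone (run_normal k.+1) Nz.
Qed.

(** [eps m] is half the doubly weighted average of [<y j - y k, v j - v k>], whose terms are
    nonnegative by monotonicity. *)
Lemma epsbar_ge0 : 0 <= eps m.
Proof.
have : 0 <= \sum_(1 <= k < m.+1 | succ k)
    (lam k * (eps m + ip (yb m - y k) (vb m - v k))).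
  rewrite big_nat_cond; apply: sumr_ge0 => -[|k]// _.
  rewrite mulr_ge0 ?(ltW (run_stepsize_gt0 k))// -(pmulr_rge0 _ Lam0).
  rewrite -weighted_ip_sum big_nat_cond; apply: sumr_ge0 => -[|j]// _.
  rewrite mulr_ge0 ?(ltW (run_stepsize_gt0 j))// (ipC ipP).
  exact: FNC_monotone (run_normal j.+1) (run_normal k.+1).
have := weighted_ip_sum (yb m) (vb m); rewrite subrr (ip0l ipP) addr0 => e.
suff -> : \sum_(1 <= k < m.+1 | succ k)
    (lam k * (eps m + ip (yb m - y k) (vb m - v k))) = Lam m * eps m + Lam m * eps m.
  by rewrite -mulr2n pmulrn_lge0// pmulr_rge0.
rewrite -{2}e {1}/Lam_sum mulr_suml -big_split /=; apply: eq_bigr => k _.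
by rewrite mulrDr -(opprB (y k)) -(opprB (v k)) (ipNl ipP) (ipNr ipP) opprK.
Qed.

(** By [displacement_sum] the vector [tau Lam vb] is [x0 - x m], and both ends lie within [|x0 - z|]
    of any solution [z]. *)
Lemma norm_vbar_le : sol !=set0 -> tau * Lam m * `|vb m| <= 2 * dist_to sol x0.
Proof.
move=> S0; rewrite [leRHS]mulrC -ler_pdivrMr//.
apply: le_dist_to => // z Sz; rewrite ler_pdivrMr//.
rewrite -mulrA -(gtr0_norm tau_gt0) -(gtr0_norm Lam0) -!normrZ scale_vbar.
rewrite -displacement_sum -(subrK z x0) -addrA.
apply: le_trans (ler_normD _ _) _; rewrite (subrK z x0) [`|z - _|]distrC.
have := iterate_dist_le m Sz; lra.
Qed.

(** [hpe_iterate_bound] places each averaged [y k] in one ball around [z], and a ball is convex. *)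
Lemma ybar_dist_le z : sol z ->
  Num.sqrt (1 - sigma ^+ 2) * `|yb m - z| <= `|x0 - z|.
Proof.
move=> Sz; rewrite -(ler_pM2l Lam0) mulrCA -(gtr0_norm Lam0) -normrZ (gtr0_norm Lam0).
rewrite scalerBr scale_ybar /Lam_sum scaler_suml -sumrB.
apply: le_trans (ler_wpM2l (sqrtr_ge0 _) (ler_norm_sum _ _ _)) _.
rewrite mulr_sumr mulr_suml big_nat_cond [leRHS]big_nat_cond.
apply: ler_sum => -[|k]// /andP[_ hs].
have l0 := run_stepsize_gt0 k.
rewrite -scalerBr normrZ (gtr0_norm l0) mulrCA ler_pM2l//.
rewrite -(ler_pXn2r (ltn0Sn 1)) ?nnegrE ?mulr_ge0 ?sqrtr_ge0// exprMn sqr_sqrtr ?(ltW oms)//.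
apply: le_trans (hpe_iterate_bound ipP l0 (ltW sigma_gt0) (large_step_residual hs) _) _.
  exact: solution_monotone.
by apply: lerXn2r; rewrite ?nnegrE ?iterate_dist_le.
Qed.

(** [fejer_sum] at the ergodic mean bounds [2 tau Lam eps] by [|x0 - yb|^2 - |x m - yb|^2]. *)
Lemma epsbar_le : sol !=set0 ->
  tau * Lam m * Num.sqrt (1 - sigma ^+ 2) * eps m <= 2 * dist_to sol x0 ^+ 2.
Proof.
move=> S0; rewrite [leRHS]mulrC -ler_pdivrMr//.
apply: le_sqr_dist_to => // z Sz; rewrite ler_pdivrMr//.
set s := Num.sqrt _.
have s0 : 0 <= s by exact: sqrtr_ge0.
have s1 : s <= 1.
  by rewrite -sqrtr1 ler_wsqrtr// gerBl sqr_ge0.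
have hy := ybar_dist_le Sz; rewrite -/s in hy.
have hx := iterate_dist_le m Sz.
have sumE : \sum_(1 <= k < m.+1 | succ k) (lam k * ip (v k) (y k - yb m)) =
    Lam m * eps m.
  have := weighted_ip_sum (yb m) 0; rewrite subrr (ip0l ipP) addr0 => <-.
  by apply: eq_bigr => k _; rewrite subr0 (ipC ipP).
have := fejer_sum m (yb m); rewrite sumE.
have sq0 : 0 <= tau * (1 - sigma ^+ 2) *
    \sum_(1 <= k < m.+1 | succ k) `|y k - x k.-1| ^+ 2.
  apply: mulr_ge0; first by rewrite mulr_ge0// ltW.
  by apply: sumr_ge0 => k _; exact: sqr_ge0.
(* Recentring at [z] cancels [|yb - z|^2]; the rest is linear in [|yb - z|], so a single factor [s]
   is spent. *)
have recenter u : `|u - yb m| ^+ 2 =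
    `|u - z| ^+ 2 - 2 * ip (u - z) (yb m - z) + `|yb m - z| ^+ 2.
  have -> : u - yb m = (u - z) - (yb m - z) by rewrite opprB addrA subrK.
  by rewrite (sqr_normB ipP (u - z)) (ipC ipP (yb m - z)).
rewrite !recenter => h.
set D := `|x0 - z| in h hx hy *; set d := `|x m - z| in h hx.
have d0 : 0 <= d by exact: normr_ge0.
have i1 := ip_norm_le ipP (x0 - z) (yb m - z).
have i2 := ip_norm_le ipP (x m - z) (yb m - z).
move: i1 i2; rewrite !ler_norml -/D -/d => /andP[i1 _] /andP[_ i2].
set n := `|yb m - z| in h hy i1 i2.
have h2 : 2 * tau * (Lam m * eps m) <= D ^+ 2 - d ^+ 2 + 2 * (D + d) * n by lra.
have h3 := ler_wpM2l s0 h2.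
have h4 : (D + d) * (s * n) <= (D + d) * D by rewrite ler_wpM2l// addr_ge0// (le_trans d0).
have h5 : s * (D ^+ 2 - d ^+ 2) <= D ^+ 2 - d ^+ 2.
  by rewrite ler_piMl// subr_ge0 ler_pXn2r// nnegrE (le_trans d0).
(* The constant comes from [D^2 - d^2 + 2 (D + d) D = 4 D^2 - (D - d)^2]. *)
have := sqr_ge0 (D - d); lra.
Qed.

End Averages.

(** * Iteration counts *)

Section Complexity.
Variable rho : R.
Hypotheses (rho0 : 0 < rho) (S0 : sol !=set0) (nz : forall k, v k != 0).
Local Notation d0 := (dist_to sol x0).
Local Notation logterm :=
  ((2 * tau)^-1 * logp ((eta + 2 * thh / L) / (lam1 ^+ 2 * rho))).

Let d0_gt0 : 0 < d0. Proof. exact: dist_to_solution_gt0. Qed.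

Let Q0 : 0 < (eta + 2 * thh / L) / (lam1 ^+ 2 * rho).
Proof.
apply: divr_gt0; last by apply: mulr_gt0 => //; apply: exprn_gt0.
by apply: addr_gt0 => //; apply: divr_gt0 => //; apply: mulr_gt0.
Qed.

(** Small steps exceed large ones by at most [c], so at least half of the other [n] iterations'
    worth are large. *)
Lemma double_nsucc_ge (n c : nat) : logterm <= c%:R ->
  (forall k, (1 <= k <= n + c)%N -> rho < `|v k|) ->
  (n <= nsucc (n + c) + nsucc (n + c))%N.
Proof.
move=> hc hv; rewrite -(leq_add2r c) -{1}(nsuccDnfail (n + c)) -addnA leq_add2l.
apply: (nfail_le rho0 hv); apply: logp_power_le1 => //.
by rewrite tau_gt0.
Qed.

Lemma small_or_large (M : nat) :
  (exists k, [/\ (1 <= k)%N, (k <= M)%N & `|v k| <= rho]) \/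
  (forall k, (1 <= k <= M)%N -> rho < `|v k|).
Proof.
have [h|h] := pselect (exists k, [/\ (1 <= k)%N, (k <= M)%N & `|v k| <= rho]).
  by left.
right=> k /andP[k1 kM]; rewrite ltNge; apply/negP => hk.
by apply: h; exists k.
Qed.

Let logterm_ge0 : 0 <= logterm.
Proof.
apply: mulr_ge0; first by rewrite invr_ge0 mulr_ge0// ltW.
by rewrite /logp le_max lexx orbT.
Qed.

Lemma pointwise_complexity :
  exists k : nat, (1 <= k)%N /\
    k%:R <= Num.max (1 : R) ((Num.ceil ((2 / (tau * eta * (1 - sigma))) *
      (d0 ^+ 2 / rho)))%:~R + (Num.ceil logterm)%:~R) /\
    normal_cone ip C (y k) (nu k) /\ `|v k| <= rho.
Proof.
have K0 : 0 < tau * eta * (1 - sigma).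
  by apply: mulr_gt0; [exact: mulr_gt0|rewrite subr_gt0].
set Y := _ * (d0 ^+ 2 / rho).
have YE : Y = 2 * ((tau * eta * (1 - sigma))^-1 * (d0 ^+ 2 / rho)).
  by rewrite mulrA.
have Y0 : 0 <= Y.
  apply: mulr_ge0; first by rewrite divr_ge0 ?(ltW K0).
  by rewrite divr_ge0 ?sqr_ge0// ltW.
have [n -> Yn] := ceil_natr Y0; have [c -> hc] := ceil_natr logterm_ge0.
rewrite -natrD; have [[k [k1 kM hk]]|hv] := small_or_large (n + c).
  exists k; split=> //; split; last by split=> //; exact: run_normal.
  by rewrite le_max ler_nat kM orbT.
(* Otherwise [Y <= n <= 2 nsucc < Y]. *)
have nA := double_nsucc_ge hc hv; have := nsucc_lt S0 nz rho0 hv.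
move: nA; rewrite -(ler_nat R) natrD; lra.
Qed.

Lemma ergodic_complexity :
  let Mb : R := Num.max
      (Num.ceil ((2 * (4 : R) `^ (3^-1) /
                   (tau * eta `^ (2 / 3) * (1 - sigma ^+ 2) `^ (3^-1)))
                 * (d0 ^+ 2 / rho) `^ (2 / 3)))%:~R
      (Num.ceil ((2 * (4 : R) `^ (3^-1) /
                   (tau * eta `^ (2 / 3) * (1 - sigma ^+ 2) `^ (2 / 3)))
                 * (d0 ^+ 3 / rho) `^ (2 / 3)))%:~R
      + (Num.ceil logterm)%:~R in
  exists (yy w : H) (e : R),
     0 <= e /\ enlargement ip (FNC ip C F) e yy w /\
     Num.max `|w| e <= rho /\
     ((exists k : nat, (1 <= k)%N /\ k%:R <= Num.max 1 Mb /\
         yy = y k /\ w = v k /\ e = 0)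
      \/
      (exists m : nat, (1 <= m)%N /\ m%:R <= Num.max 1 Mb /\
         (exists k : nat, (1 <= k <= m)%N /\ succ k) /\
         yy = yb m /\ w = vb m /\ e = eps m)).
Proof.
set Y1 := _ * _ `^ _; set Y2 := _ * (d0 ^+ 3 / rho) `^ _.
have e30 : 0 < eta `^ (2 / 3) by exact: powR_gt0.
have w10 : 0 < (1 - sigma ^+ 2) `^ 3^-1 by exact: powR_gt0.
have w20 : 0 < (1 - sigma ^+ 2) `^ (2 / 3) by exact: powR_gt0.
have q10 : 0 < d0 ^+ 2 / rho by apply: divr_gt0 => //; exact: exprn_gt0.
have q20 : 0 < d0 ^+ 3 / rho by apply: divr_gt0 => //; exact: exprn_gt0.
have coef0 w : 0 < w -> 0 < 2 * (4 : R) `^ (3^-1) / (tau * eta `^ (2 / 3) * w).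
  move=> w0; apply: divr_gt0; first by rewrite mulr_gt0// powR_gt0.
  by apply: mulr_gt0 => //; exact: mulr_gt0.
have Y10 : 0 < Y1 by apply: mulr_gt0; [exact: coef0|exact: powR_gt0].
have Y20 : 0 < Y2 by apply: mulr_gt0; [exact: coef0|exact: powR_gt0].
have [n1 -> Yn1] := ceil_natr (ltW Y10); have [n2 -> Yn2] := ceil_natr (ltW Y20).
have [c -> hc] := ceil_natr logterm_ge0.
rewrite -natr_max -natrD /=; set n := maxn n1 n2.
(* An iterate with small residual serves by itself with [eps = 0]; only in its absence are the
   averages taken. *)
have [[k [k1 kM hk]]|hv] := small_or_large (n + c).
  exists (y k), (v k), 0; split=> //; split; last first.
    split; first by rewrite ge_max hk ltW.
    by left; exists k; split=> //; split=> //; rewrite le_max ler_nat kM orbT.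
  move=> z _ [mu Nz <-]; rewrite oppr0.
  exact: FNC_monotone (run_normal k) Nz.
have nA := double_nsucc_ge hc hv.
set M := (n + c)%N in hv nA *; set A := nsucc M in nA.
have YA1 : Y1 <= 2 * A%:R.
  apply: le_trans Yn1 _; rewrite -natrM ler_nat; apply: leq_trans (leq_maxl n1 n2) _.
  by rewrite mul2n -addnn.
have YA2 : Y2 <= 2 * A%:R.
  apply: le_trans Yn2 _; rewrite -natrM ler_nat; apply: leq_trans (leq_maxr n1 n2) _.
  by rewrite mul2n -addnn.
have A0 : (0 < A)%N by rewrite -(ltr_nat R); lra.
have M1 : (1 <= M)%N by rewrite -(nsuccDnfail M) (leq_trans A0)// leq_addr.
have := le_cube_of_powR_le tau_gt0 eta_gt0 w10 (ltW (exprn_gt0 2 d0_gt0)) rho0 YA1.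
have := le_cube_of_powR_le tau_gt0 eta_gt0 w20 (ltW (exprn_gt0 3 d0_gt0)) rho0 YA2.
rewrite powR_third_cube ?(ltW oms)// powR_two_thirds_cube ?(ltW oms)//.
move=> h2 h1.
have hL := Lam_sum_ge M S0; rewrite -/A in hL.
have Lam0 := Lam_sum_gt0 A0.
set a := (A%:R : R) in h1 h2 hL; set l := Lam M in hL Lam0 *.
have tr0 : 0 < tau ^+ 2 * rho ^+ 2 by rewrite mulr_gt0// exprn_gt0.
have hL2 := ler_wpM2l (ltW tr0) hL.
have v_rho : `|vb M| <= rho.
  (* After multiplication by [d0 ^+ 2], [h1] and [hL2] chain through
     [A^3 tau^3 eta^2 (1 - sigma^2) rho^2]. *)
  have : (2 * d0) ^+ 2 <= (tau * l * rho) ^+ 2.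
    rewrite -(ler_pM2r (exprn_gt0 2 d0_gt0)).
    apply: le_trans (_ : tau ^+ 2 * rho ^+ 2 * (l ^+ 2 * d0 ^+ 2) <= _); last lra.
    by apply: le_trans hL2; lra.
  have tl0 : 0 < tau * l by exact: mulr_gt0.
  have dd0 : 0 <= 2 * d0 by rewrite mulr_ge0// ltW.
  rewrite ler_pXn2r ?nnegrE//; last exact: mulr_ge0 (ltW tl0) (ltW rho0).
  move=> h.
  rewrite -(ler_pM2l tl0); apply: le_trans h; exact: norm_vbar_le.
have e_rho : eps M <= rho.
  set s := Num.sqrt (1 - sigma ^+ 2).
  have s0 : 0 < s by rewrite sqrtr_gt0.
  have s2 : s ^+ 2 = 1 - sigma ^+ 2 by rewrite sqr_sqrtr ?(ltW oms).
  (* The same chain with [h2], where [s^2] supplies the second factor [1 - sigma^2]. *)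
  have : (2 * d0 ^+ 2) ^+ 2 <= (tau * l * s * rho) ^+ 2.
    rewrite -(ler_pM2r (exprn_gt0 2 d0_gt0)).
    have hL3 := ler_wpM2l (ltW oms) hL2.
    apply: le_trans (_ : (1 - sigma ^+ 2) *
      (tau ^+ 2 * rho ^+ 2 * (l ^+ 2 * d0 ^+ 2)) <= _).
      by apply: le_trans hL3; lra.
    by rewrite -s2; lra.
  have tls0 : 0 < tau * l * s by apply: mulr_gt0 => //; exact: mulr_gt0.
  have dd0 : 0 <= 2 * d0 ^+ 2 by rewrite mulr_ge0// sqr_ge0.
  rewrite ler_pXn2r ?nnegrE//; last exact: mulr_ge0 (ltW tls0) (ltW rho0).
  move=> h.
  rewrite -(ler_pM2l tls0); apply: le_trans h; exact: epsbar_le.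
exists (yb M), (vb M), (eps M); split; first exact: epsbar_ge0.
split; first exact: vbar_enlargement.
split; first by rewrite ge_max v_rho.
right; exists M; split=> //; split; first by rewrite le_max lexx orbT.
by split=> //; exact: nsucc_gt0.
Qed.

End Complexity.

End Run.
Theorem theorem4p9 (R : realType) (H : completeNormedModType R)
  (ip : H -> H -> R) (C : set H) (F : H -> H) (F' : H -> H -> H) (L : R)
  (sh th eta lam1 rho : R) (x0 : H)
  (x y nu : nat -> H) (lam : nat -> R) :
  is_inner_product ip ->
  C !=set0 -> closed C -> convex_set C ->
  monotone_on ip C F -> derivative_on C F F' -> 0 < L ->
  lipschitz_deriv_on C F' L ->
  [set z | FNC ip C F z 0] !=set0 ->
  0 <= sh -> sh < 1 / 2 ->
  0 < th -> th < (1 - sh) * (1 - 2 * sh) ->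
  2 * thetah sh th / L < eta ->
  C x0 -> 0 < lam1 -> lam1 ^+ 2 * `|F x0| <= 2 * th / L ->
  alg2_run ip C F F' L sh th eta lam1 x0 x y nu lam ->
  (forall k, F (y k) + nu k != 0) ->
  0 < rho ->
  let thh := thetah sh th in
  let tau := tau_of sh th eta L in
  let d0 := dist_to [set z | FNC ip C F z 0] x0 in
  let sigma := 2 * thh / (eta * L) in
  let lterm : R := (Num.ceil ((2 * tau)^-1 *
                  logp ((eta + 2 * thh / L) / (lam1 ^+ 2 * rho))))%:~R in
  let Ma : R := (Num.ceil ((2 / (tau * eta * (1 - sigma))) * (d0 ^+ 2 / rho)))%:~R
            + lterm in
  let Mb : R := Num.max
      (Num.ceil ((2 * (4 : R) `^ (3^-1) /
                   (tau * eta `^ (2 / 3) * (1 - sigma ^+ 2) `^ (3^-1)))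
                 * (d0 ^+ 2 / rho) `^ (2 / 3)))%:~R
      (Num.ceil ((2 * (4 : R) `^ (3^-1) /
                   (tau * eta `^ (2 / 3) * (1 - sigma ^+ 2) `^ (2 / 3)))
                 * (d0 ^+ 3 / rho) `^ (2 / 3)))%:~R
      + lterm in
  (* (a) *)
  (exists k : nat, (1 <= k)%N /\ k%:R <= Num.max 1 Ma /\
     normal_cone ip C (y k) (nu k) /\ `|F (y k) + nu k| <= rho)
  /\
  (* (b) *)
  (exists (yy v : H) (eps : R),
     0 <= eps /\ enlargement ip (FNC ip C F) eps yy v /\
     Num.max `|v| eps <= rho /\
     ((exists k : nat, (1 <= k)%N /\ k%:R <= Num.max 1 Mb /\
         yy = y k /\ v = F (y k) + nu k /\ eps = 0)
      \/
      (exists m : nat, (1 <= m)%N /\ m%:R <= Num.max 1 Mb /\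
         (exists k : nat, (1 <= k <= m)%N /\ succ_it eta x y lam k) /\
         yy = ybar eta x y lam m /\ v = vbar F eta x y nu lam m /\
         eps = epsbar ip F eta x y nu lam m))).
Proof.
move=> ipP C0 closC convC monF dF L0 lipF' S0 sh0 sh12 th0 th_lt eta_gt Cx0 lam10.
move=> lam1_le run nz rho0 /=; split.
  exact: (pointwise_complexity ipP convC monF dF L0 lipF' sh0 sh12 th0 th_lt
    eta_gt Cx0 lam10 lam1_le run rho0 S0 nz).
exact: (ergodic_complexity ipP convC monF dF L0 lipF' sh0 sh12 th0 th_lt
  eta_gt Cx0 lam10 lam1_le run rho0 S0 nz).
Qed.
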